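(* Let $\mathfrak H$ be a separable Hilbert space and let $A$ be a closed, densely defined, simple symmetric operator in $\mathfrak H$ with equal finite deficiency indices $d=n_+(A)=n_-(A)<\infty$. Let $I=(\mu_1,\mu_2)$, $-\infty\le\mu_1<\mu_2\le\infty$, be an interval such that the set $I\setminus\widetilde\rho_I(A)$ is at most countable, where $\widetilde\rho_I(A)=\{\lambda\in I:\dim\operatorname{Ker}(A^*-\lambda)=d\}$. Then: 1) for each self-adjoint extension $\widetilde A\supset A$ (in $\mathfrak H$) the intersection $\sigma_c(\widetilde A)\cap I$ is empty and the set $\sigma(\widetilde A)\cap I$ is nowhere dense in $I$; 2) the set $I\setminus\hat\rho_I(A)$ is nowhere dense in $I$, where $\hat\rho_I(A)=\hat\rho(A)\cap I$.
   Context: A symmetric operator $A$ is simple if there is no nonzero closed subspace reducing $A$ on which $A$ is self-adjoint. The defect subspaces are $\mathfrak N_z(A)=\operatorname{Ker}(A^*-z)$, $z\in\mathbb C$, and the deficiency indices are $n_\pm(A)=\dim\mathfrak N_z(A)$ for $z\in\mathbb C_\pm$ (upper/lower half-plane). For simple $A$ one has $\operatorname{Ker}(A-\lambda)=\{0\}$ and $\dim\mathfrak N_\lambda(A)\le d$ for all $\lambda\in\mathbb R$. The set of regular type points of a closed operator $T$ is $\hat\rho(T)=\{\lambda\in\mathbb C:\operatorname{Ker}(T-\lambda)=\{0\},\ \mathcal R(T-\lambda)\text{ is closed}\}$, where $\mathcal R$ denotes the range. For a self-adjoint operator $T$ in $\mathfrak H$, $\sigma(T)$ is its spectrum and $\sigma_p(T)=\{\lambda\in\mathbb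 R:\operatorname{Ker}(T-\lambda)\ne\{0\}\}$ its point spectrum. The continuous spectrum $\sigma_c(T)$ is the spectrum of the self-adjoint operator $T\upharpoonright\mathfrak H_c$, where $\mathfrak H_c$ is the orthogonal complement in $\mathfrak H$ of the closed linear span of all $\operatorname{Ker}(T-\lambda)$, $\lambda\in\sigma_p(T)$ (this subspace reduces $T$). A set $X\subset(\mu_1,\mu_2)$ is nowhere dense in $(\mu_1,\mu_2)$ if every interval $(\mu_1',\mu_2')\subset(\mu_1,\mu_2)$ contains an interval $(\mu_1'',\mu_2'')$ with $X\cap(\mu_1'',\mu_2'')=\emptyset$. *)

(* Defs.v *)
From HB Require Import structures.
From mathcomp Require Import all_boot all_order all_algebra.
From mathcomp Require Import sesquilinear complex.
From mathcomp Require Import mathcomp_extra boolp classical_sets functions.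
From mathcomp Require Import cardinality reals ereal topology normedtype.

Set Implicit Arguments.
Unset Strict Implicit.
Unset Printing Implicit Defensive.

Import Order.TTheory GRing.Theory Num.Theory.
Import numFieldNormedType.Exports.

Local Open Scope classical_set_scope.
Local Open Scope ring_scope.
Local Open Scope complex_scope.

Section Hilbert.
Context {R : realType} {H : completeNormedModType R[i]}.

(* A complex Hilbert space is a complete normed space H together with an inner
   product inducing its norm. *)
Definition hilbert (dot : {dot H for Num.conj}) :=
  forall x : H, `|x| ^+ 2 = dot x x.

Definition separable := exists S : set H, countable S /\ dense S.

Definition subspace_of (V : lmodType R[i]) (M : set V) :=
  M 0 /\ forall (a : R[i]) x y, M x -> M y -> M (a *: x + y).

Definition closed_subspace (M : set H) := subspace_of M /\ closed M.

Definition closed_span (S : set H) : set H := smallest closed_subspace S.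

Definition has_dim (M : set H) (n : nat) := exists e : 'I_n -> H,
  (forall c : 'I_n -> R[i],
     \sum_(i < n) c i *: e i = 0 -> forall i, c i = 0) /\
  M = [set \sum_(i < n) c i *: e i | c in [set: 'I_n -> R[i]]].

(* Unbounded operators are represented by their graphs, T (x, y) meaning
   "x belongs to the domain of T and T x = y"; inclusion of graphs is extension
   of operators. *)
Definition operator (T : set (H * H)) :=
  subspace_of T /\ forall x y z, T (x, y) -> T (x, z) -> y = z.

Definition dom (T : set (H * H)) : set H := [set x | exists y, T (x, y)].

(* Ker (T - z) *)
Definition ker (T : set (H * H)) (z : R[i]) : set H :=
  [set x | T (x, z *: x)].

(* the range of T - z *)
Definition ran (T : set (H * H)) (z : R[i]) : set H :=
  [set p.2 - z *: p.1 | p in T].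

Definition restr (T : set (H * H)) (M : set H) : set (H * H) :=
  T `&` (M `*` M).

(* points of regular type *)
Definition reg_type (T : set (H * H)) : set R[i] :=
  [set z | ker T z = [set 0] /\ closed (ran T z)].

(* In the next three definitions M is the ambient Hilbert space, a closed
   subspace of H, and T is a subset of M `*` M. M = setT gives the notions for
   operators in H itself. *)

Definition densely_defined (M : set H) (T : set (H * H)) :=
  M `<=` closure (dom T).

Definition resolvent_set (M : set H) (T : set (H * H)) : set R[i] :=
  [set z | [/\ ker T z = [set 0], ran T z = M &
     exists c : R, forall x y, T (x, y) -> `|x| <= c%:C * `|y - z *: x| ]].

Definition spectrum (M : set H) (T : set (H * H)) : set R[i] :=
  ~` resolvent_set M T.

Definition point_spectrum (T : set (H * H)) : set R :=
  [set l | ker T l%:C != [set 0]].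

Section Dot.
Variable dot : {dot H for Num.conj}.

Definition orth (S : set H) : set H :=
  [set y | forall x, S x -> dot x y = 0].

(* adjoint of T in the ambient space M *)
Definition adjoint (M : set H) (T : set (H * H)) : set (H * H) :=
  [set p | [/\ M p.1, M p.2 & forall q, T q -> dot q.2 p.1 = dot q.1 p.2]].

Definition symmetric_operator (T : set (H * H)) :=
  operator T /\ T `<=` adjoint setT T.

Definition selfadjoint (M : set H) (T : set (H * H)) :=
  [/\ operator T, densely_defined M T & T = adjoint M T].

(* P T `<=` T P for the orthogonal projection P onto M: the pair q is
   (P x, P (T x)) for p = (x, T x). *)
Definition reduces (M : set H) (T : set (H * H)) :=
  closed_subspace M /\
  forall p, T p -> exists q,
    [/\ T q, M q.1, M q.2, orth M (p.1 - q.1) & orth M (p.2 - q.2)].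

Definition simple_operator (T : set (H * H)) :=
  forall M : set H, reduces M T -> selfadjoint M (restr T M) -> M = [set 0].

Definition defect (A : set (H * H)) (z : R[i]) : set H :=
  ker (adjoint setT A) z.

Definition defect_index_upper (A : set (H * H)) (d : nat) :=
  forall z : R[i], 0 < complex.Im z -> has_dim (defect A z) d.

Definition defect_index_lower (A : set (H * H)) (d : nat) :=
  forall z : R[i], complex.Im z < 0 -> has_dim (defect A z) d.

Definition cont_subspace (T : set (H * H)) : set H :=
  orth (closed_span (\bigcup_(l in point_spectrum T) ker T l%:C)).

Definition cont_spectrum (T : set (H * H)) : set R[i] :=
  spectrum (cont_subspace T) (restr T (cont_subspace T)).

End Dot.
End Hilbert.

Arguments separable {R} H.

Section Intervals.
Context {R : realType}.

Definition oint (a b : \bar R) : set R := [set x | (a < x%:E)%E /\ (x%:E < b)%E].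

Definition nowhere_dense_in (a b : \bar R) (X : set R) :=
  X `<=` oint a b /\
  forall a1 b1 : \bar R, (a1 < b1)%E -> oint a1 b1 `<=` oint a b ->
  exists a2 b2 : \bar R,
    [/\ (a2 < b2)%E, oint a2 b2 `<=` oint a1 b1 & X `&` oint a2 b2 = set0].

(* the real points of a subset of the complex plane *)
Definition real_trace (S : set R[i]) : set R := [set l | S l%:C].

End Intervals.

(* Main.v *)
Require Import Defs.
From HB Require Import structures.
From mathcomp Require Import all_boot all_order all_algebra.
From mathcomp Require Import sesquilinear complex.
From mathcomp Require Import mathcomp_extra boolp classical_sets functions.
From mathcomp Require Import cardinality reals ereal topology normedtype.
From mathcomp Require Import sequences zify ring lra finmap.
Import Order.TTheory GRing.Theory Num.Theory.
Import numFieldNormedType.Exports.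
Local Open Scope classical_set_scope.
Local Open Scope ring_scope.
Local Open Scope complex_scope.

(** Why the theorem holds. Let T be a selfadjoint extension of A, with resolvent
    (T - z)^-1 ([res T z]), and let N = Ker (A^* - i).

    If dim Ker (A^* - t) = d and t is not an eigenvalue of T, then the injective map
    g |-> g - (t - i) (T - i)^-1 g from Ker (A^* - t) to N is onto, since both spaces have
    dimension d; this means that N is contained in the range of T - t
    ([defect_in_ran]). By hypothesis, and because a separable space carries only
    countably many eigenvalues, this happens for all but countably many t in I. In
    terms of the spectral measure m of T at a vector f of N, it says that the integral of
    (s - t)^-2 dm(s) is finite for all but countably many t. Such a measure has no
    continuous part on I: where the integral is at most C, an interval of radius b
    has mass O(C b^2), so that subdivision gives mass zero. By Baire's theorem
    the integral is even bounded on some subinterval of any given interval, which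
    therefore has mass zero. Since A is simple, N generates the whole space under the
    resolvent of T ([defect_generates]), so that these conclusions pass from the
    vectors of N to T itself: T has no continuous spectrum in I, and every subinterval
    of I contains an interval in the resolvent set.

    No spectral measure is constructed. It is replaced by the numbers
    b^2 |(T - a - i b)^-1 f|^2, which control the mass of the interval with centre a and
    radius b, and by one positivity statement, [spectral_pos]: an inequality
    w0 + sum_i w_i |t - z_i|^-2 >= 0 on the real line implies
    w0 |f|^2 + sum_i w_i |(T - z_i)^-1 f|^2 >= 0. It holds because a positive real
    polynomial is of the form q q^* with q complex. Its consequence [null_bound] says
    that (T - l)^-1 is bounded by 1/d on f as soon as f has no mass within distance d of l,
    and [resolvent_of_bound] concludes that l is in the resolvent set once this holds
    for a dense set of vectors f.

    The second claim follows from the first: the points of I in the resolvent set of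
    one selfadjoint extension are of regular type for A. An extension exists because
    the interval contains a real l with dim Ker (A^* - l) = d: adding Ker (A^* - l)
    to the domain of A enlarges it symmetrically by d dimensions, as many as are
    needed for T + i and T - i to be onto ([selfadjoint_extension]). *)

Set Implicit Arguments.
Unset Strict Implicit.
Unset Printing Implicit Defensive.

(** * Real-valued norms, inner products, orthogonal projections *)

Section ComplexNumbers.
Context {R : realType}.
Implicit Types a b z : R[i].

(** The order of R[i] is only partial, so all estimates below are carried out in R,
    with the modulus [cn] and the norm [nm] as real numbers. *)
Definition cn z : R := complex.Re `|z|.

Lemma cnE z : `|z| = (cn z)%:C.
Proof. by rewrite RRe_real // normr_real. Qed.

Lemma realC_eq0 (t : R) : (t%:C == 0) = (t == 0).
Proof. by rewrite -(inj_eq (@complexI R)). Qed.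

Lemma cn_ge0 z : 0 <= cn z.
Proof. by rewrite -lecR -cnE normr_ge0. Qed.

Lemma cnM a b : cn (a * b) = cn a * cn b.
Proof. by apply: complexI; rewrite -cnE normrM !cnE rmorphM. Qed.

Lemma cnN a : cn (- a) = cn a.
Proof. by rewrite /cn normrN. Qed.

Lemma cnD a b : cn (a + b) <= cn a + cn b.
Proof. by rewrite -lecR rmorphD /= -!cnE ler_normD. Qed.

Lemma cn_real (t : R) : cn t%:C = `|t|.
Proof. by rewrite /cn normc_def /= expr0n addr0 sqrtr_sqr. Qed.

Lemma cn0 : cn 0 = 0. Proof. by rewrite /cn normr0. Qed.

Lemma cn_eq0 a : (cn a == 0) = (a == 0).
Proof. by rewrite -(normr_eq0 a) cnE realC_eq0. Qed.

Lemma cn_sq a : cn a ^+ 2 = complex.Re a ^+ 2 + complex.Im a ^+ 2.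
Proof. by apply: complexI; rewrite rmorphXn /= -cnE add_Re2_Im2. Qed.

Lemma cn_i : cn 'i = 1.
Proof. by rewrite /cn normc_def /= expr0n /= add0r expr1n sqrtr1. Qed.

Lemma Im_le_cn a : `|complex.Im a| <= cn a.
Proof.
by rewrite -ler_sqr ?nnegrE ?cn_ge0 // cn_sq real_normK ?num_real // lerDr sqr_ge0.
Qed.

End ComplexNumbers.

Section Subspaces.
Context {R : realType} {V : lmodType R[i]}.
Implicit Types (M : set V) (x y : V).

Lemma subspaceD M : subspace_of M -> forall x y, M x -> M y -> M (x + y).
Proof. by move=> [_ h] x y Mx My; rewrite -[x]scale1r; apply: h. Qed.

Lemma subspaceZ M : subspace_of M -> forall a x, M x -> M (a *: x).
Proof. by move=> [M0 h] a x Mx; rewrite -[_ *: _]addr0; apply: h. Qed.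

Lemma subspaceB M : subspace_of M -> forall x y, M x -> M y -> M (x - y).
Proof.
by move=> [_ h] x y Mx My; rewrite addrC -scaleN1r; apply: h.
Qed.

Lemma subspace_sum M : subspace_of M -> forall n (F : 'I_n -> V),
  (forall i, M (F i)) -> M (\sum_(i < n) F i).
Proof.
move=> sM n F hF; apply: (big_ind M) => //; first by case: sM.
exact: subspaceD.
Qed.

End Subspaces.

Section HilbertSpace.
Context {R : realType} {H : completeNormedModType R[i]}.
Implicit Types (x y z u v : H) (a : R[i]) (M : set H).

Definition nm x : R := complex.Re `|x|.

Lemma nmE x : `|x| = (nm x)%:C.
Proof. by rewrite RRe_real // normr_real. Qed.

Lemma nm_ge0 x : 0 <= nm x.
Proof. by rewrite -lecR -nmE normr_ge0. Qed.

Lemma nm_eq0 x : (nm x == 0) = (x == 0).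
Proof. by rewrite -(normr_eq0 x) nmE realC_eq0. Qed.

Lemma nm0 : nm 0 = 0. Proof. by rewrite /nm normr0. Qed.

Lemma nmN x : nm (- x) = nm x. Proof. by rewrite /nm normrN. Qed.

Lemma nmBC x y : nm (x - y) = nm (y - x). Proof. by rewrite /nm distrC. Qed.

Lemma nmD x y : nm (x + y) <= nm x + nm y.
Proof. by rewrite -lecR rmorphD /= -!nmE ler_normD. Qed.

Lemma nm_dist x y z : nm (x - z) <= nm (x - y) + nm (y - z).
Proof. by rewrite -[x - z](subrKA y) nmD. Qed.

Lemma nmZ a x : nm (a *: x) = cn a * nm x.
Proof. by apply: complexI; rewrite -nmE normrZ nmE cnE rmorphM. Qed.

Lemma nmZr (t : R) x : nm (t%:C *: x) = `|t| * nm x.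
Proof. by rewrite nmZ cn_real. Qed.

Lemma gt0_real (e : R[i]) : 0 < e -> exists2 r : R, 0 < r & e = r%:C.
Proof. by case: e => a b; rewrite ltcE /= => /andP[/eqP-> a0]; exists a. Qed.

Lemma nbhs_nm x (A : set H) :
  nbhs x A <-> exists2 e : R, 0 < e & forall y, nm (x - y) < e -> A y.
Proof.
split.
  case/nbhs_ballP => _ /= /gt0_real[r r0 ->] h; exists r => // y hy.
  by apply: h; rewrite -ball_normE /= nmE ltcR.
case=> e e0 h; apply/nbhs_ballP; exists e%:C => /=; first by rewrite ltcR.
by move=> y; rewrite -ball_normE /= nmE ltcR; exact: h.
Qed.

(** Closure phrased with the real norm. The analogue for graphs, [closed_adherent2],
    replaces the product topology by two independent estimates. *)
Definition adherent M x := forall e : R, 0 < e -> exists2 y, M y & nm (x - y) < e.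

Lemma closure_nm M x : closure M x <-> adherent M x.
Proof.
split=> [h e e0|h A /nbhs_nm[e e0 he]].
  have [|y [My hy]] := h [set y | nm (x - y) < e].
    by apply/nbhs_nm; exists e.
  by exists y.
by have [y My hy] := h _ e0; exists y; split => //; apply: he.
Qed.

Lemma closed_adherent M : closed M <-> forall x, adherent M x -> M x.
Proof.
by split=> h x hx; apply: h; apply/closure_nm.
Qed.

Lemma closed_adherent2 (T : set (H * H)) : closed T <->
  forall x y, (forall e : R, 0 < e ->
     exists p, [/\ T p, nm (x - p.1) < e & nm (y - p.2) < e]) -> T (x, y).
Proof.
split=> [h x y hxy|h [x y] hxy].
  apply: h => A [[B1 B2]] /= [/nbhs_nm[e1 e10 h1] /nbhs_nm[e2 e20 h2]] hB.
  have [|[u v] /= [Tp n1 n2]] := hxy (Num.min e1 e2); first by rewrite lt_min e10.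
  exists (u, v); split => //; apply: hB; split => /=.
    by apply: h1; rewrite (lt_le_trans n1) // ge_min lexx.
  by apply: h2; rewrite (lt_le_trans n2) // ge_min lexx orbT.
apply: h => e e0.
have [|[u v] /= [Tp [n1 n2]]] := hxy
  ([set u | nm (x - u) < e] `*` [set u | nm (y - u) < e]).
  by exists ([set u | nm (x - u) < e], [set u | nm (y - u) < e]) => //=;
    split; apply/nbhs_nm; exists e.
by exists (u, v).
Qed.

Definition tends (u : nat -> H) (l : H) :=
  forall e : R, 0 < e -> exists N, forall n, (N <= n)%N -> nm (l - u n) < e.

Lemma cauchy_tends (u : nat -> H) :
  (forall e : R, 0 < e -> exists N, forall m n, (N <= m)%N -> (N <= n)%N ->
     nm (u m - u n) < e) -> exists l, tends u l.
Proof.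
move=> hc.
have /cauchy_cvgP uc : cauchy (u @ \oo).
  apply/cauchy_ballP => _ /gt0_real[r r0 ->].
  have [N hN] := hc _ r0.
  exists (u @` [set m | (N <= m)%N], u @` [set m | (N <= m)%N]) => /=.
    by split; exists N => // m hm; exists m.
  move=> [_ _] /= [[m hm <-] [n hn <-]].
  by rewrite -ball_normE /= nmE ltcR hN.
exists (lim (u @ \oo)) => e e0.
have /cvgrPdist_lt /(_ e%:C) h := uc.
have [|N _ hN] := h; first by rewrite ltcR.
by exists N => n hn; have := hN n hn; rewrite /= nmE ltcR.
Qed.

Lemma tends_adherent M (u : nat -> H) l : (forall n, M (u n)) ->
  tends u l -> adherent M l.
Proof.
by move=> Mu ul e e0; have [N hN] := ul e e0; exists (u N) => //; exact: hN.
Qed.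

Context {dot : {dot H for Num.conj}}.

Lemma dotC x y : dot x y = (dot y x)^*%C.
Proof. by rewrite hermC /= expr0 mul1r. Qed.
Lemma dotDl x y u : dot (x + y) u = dot x u + dot y u.
Proof. by rewrite linearDl. Qed.
Lemma dotDr x y u : dot u (x + y) = dot u x + dot u y.
Proof. by rewrite linearDr. Qed.
Lemma dotBl x y u : dot (x - y) u = dot x u - dot y u.
Proof. by rewrite linearBl. Qed.
Lemma dotBr x y u : dot u (x - y) = dot u x - dot u y.
Proof. by rewrite linearBr. Qed.
Lemma dotNr x y : dot x (- y) = - dot x y.
Proof. by rewrite linearNr. Qed.
Lemma dotZl a x y : dot (a *: x) y = a * dot x y.
Proof. by rewrite linearZl. Qed.
Lemma dotZr a x y : dot x (a *: y) = a^*%C * dot x y.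
Proof. by rewrite linearZr. Qed.
Lemma dot0l x : dot 0 x = 0. Proof. by rewrite linear0l. Qed.
Lemma dot0r x : dot x 0 = 0. Proof. by rewrite linear0r. Qed.


Lemma dot_suml n (F : 'I_n -> H) y :
  dot (\sum_(i < n) F i) y = \sum_(i < n) dot (F i) y.
Proof.
exact: (big_morph (fun x => dot x y) (fun u v => dotDl u v y) (dot0l y)).
Qed.

Lemma dot_sumr n (F : 'I_n -> H) y :
  dot y (\sum_(i < n) F i) = \sum_(i < n) dot y (F i).
Proof.
exact: (big_morph (fun x => dot y x) (fun u v => dotDr u v y) (dot0r y)).
Qed.

Context (hH : hilbert dot).

Lemma dotxx x : dot x x = (nm x ^+ 2)%:C.
Proof. by rewrite -hH nmE rmorphXn. Qed.

Lemma dotxx0 x : dot x x = 0 -> x = 0.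
Proof.
by rewrite dotxx => /eqP; rewrite realC_eq0 sqrf_eq0 nm_eq0 => /eqP.
Qed.

Lemma nm_sqD x y : nm (x + y) ^+ 2 = nm x ^+ 2 + nm y ^+ 2 + 2 * complex.Re (dot x y).
Proof.
have E : dot (x + y) (x + y) = dot x x + dot y y + (dot x y + (dot x y)^*%C).
  by rewrite !(dotDl, dotDr) (dotC y x); ring.
move: E; rewrite !dotxx => /(congr1 (@complex.Re R)).
case: (dot x y) => p q /= -> /=; ring.
Qed.

Lemma pythagoras x y : dot x y = 0 -> nm (x + y) ^+ 2 = nm x ^+ 2 + nm y ^+ 2.
Proof. by move=> h; rewrite nm_sqD h /= mulr0 addr0. Qed.

Lemma cauchy_schwarz x y : cn (dot x y) <= nm x * nm y.
Proof.
have [->|y0] := eqVneq y 0; first by rewrite dot0r cn0 nm0 mulr0.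
have ny : 0 < nm y by rewrite lt_def nm_eq0 y0 nm_ge0.
pose c := dot x y / (nm y ^+ 2)%:C.
have nz : (nm y ^+ 2)%:C != 0 by rewrite realC_eq0 sqrf_eq0 nm_eq0.
have o : dot (x - c *: y) (c *: y) = 0.
  by rewrite dotZr dotBl dotZl dotxx /c divfK // subrr mulr0.
have := pythagoras o; rewrite subrK nmZ => P.
have cy : cn c * nm y <= nm x.
  rewrite -ler_sqr ?nnegrE ?nm_ge0 ?mulr_ge0 ?cn_ge0 ?nm_ge0 // P lerDr sqr_ge0.
  done.
have -> : dot x y = c * (nm y ^+ 2)%:C by rewrite /c divfK.
rewrite cnM cn_real ger0_norm ?sqr_ge0 // expr2 mulrA ler_wpM2r ?nm_ge0 //.
Qed.

(** The inner product is continuous, by Cauchy-Schwarz. *)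
Lemma dot_near0 M y x : (forall u, M u -> dot u y = 0) -> adherent M x -> dot x y = 0.
Proof.
move=> h hx; apply/eqP; rewrite -cn_eq0 eq_le cn_ge0 andbT.
apply/ler_addgt0Pr => e e0; rewrite add0r.
have [|u Mu hu] := hx (e / (nm y + 1)).
  by rewrite divr_gt0 // ltr_wpDl ?nm_ge0.
have -> : dot x y = dot (x - u) y by rewrite dotBl (h u) // subr0.
apply: (le_trans (cauchy_schwarz _ _)).
have n1 : 0 < nm y + 1 by rewrite ltr_wpDl ?nm_ge0.
have : nm (x - u) * (nm y + 1) <= e by rewrite -ler_pdivlMr // ltW.
by apply: le_trans; rewrite ler_wpM2l ?nm_ge0 // lerDl.
Qed.

Lemma dot_dense0 M y : (forall x, adherent M x) ->
  (forall u, M u -> dot u y = 0) -> y = 0.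
Proof. by move=> hM h; apply: dotxx0; apply: (dot_near0 (M := M)). Qed.

Lemma orth_closed_subspace (S : set H) : closed_subspace (orth dot S).
Proof.
split; first split.
- by move=> x _; rewrite dot0r.
- by move=> a x y hx hy u Su; rewrite dotDr dotZr hx // hy // mulr0 addr0.
apply/closed_adherent => x hx u Su.
rewrite dotC; apply/eqP; rewrite conjc_eq0; apply/eqP.
by apply: (dot_near0 (M := orth dot S)) => // v /(_ _ Su); rewrite dotC => /eqP;
  rewrite conjc_eq0 => /eqP.
Qed.

Lemma parallelogram x y :
  nm (x - y) ^+ 2 + nm (x + y) ^+ 2 = 2 * (nm x ^+ 2 + nm y ^+ 2).
Proof.
rewrite !nm_sqD nmN dotNr.
have -> : complex.Re (- dot x y) = - complex.Re (dot x y) by case: (dot x y).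
ring.
Qed.

(** The midpoint of two almost nearest points of a subspace is again in the
   subspace, so the parallelogram law makes a minimising sequence Cauchy. *)
Lemma projection_exists M : closed_subspace M ->
  forall x, exists2 p, M p & orth dot M (x - p).
Proof.
move=> [sM cM] x; have [M0 _] := sM.
pose S := [set nm (x - m) ^+ 2 | m in M].
have Si : has_inf S.
  split; first by exists (nm (x - 0) ^+ 2), 0.
  by exists 0 => _ [m _ <-]; rewrite sqr_ge0.
pose D := inf S.
have D_le m : M m -> D <= nm (x - m) ^+ 2.
  by move=> Mm; apply: ge_inf; [case: Si | exists m].
have ex n : exists m, M m /\ nm (x - m) ^+ 2 < D + n.+1%:R^-1.
  have [|_ [m Mm <-] hm] := inf_adherent (eps := n.+1%:R^-1) _ Si.
    by rewrite invr_gt0 ltr0n.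
  by exists m; split.
have [u hu] := choice ex.
have near_min m m' e : M m -> M m' -> nm (x - m) ^+ 2 < D + e ->
    nm (x - m') ^+ 2 < D + e -> nm (m - m') ^+ 2 <= 4 * e.
  move=> Mm Mm' h1 h2.
  have := parallelogram (x - m) (x - m').
  have -> : x - m - (x - m') = m' - m by rewrite opprB addrC addrA subrK.
  rewrite nmBC.
  have -> : x - m + (x - m') = 2%:C *: (x - 2^-1%:C *: (m + m')).
    rewrite scalerBr scalerA -rmorphM /= divff ?pnatr_eq0 // scale1r.
    rewrite (_ : 2%:C = 1 + 1) ?rmorphD ?rmorph1 // scalerDl !scale1r.
    by rewrite addrACA opprD.
  rewrite nmZr ger0_norm ?ler0n // exprMn.
  have := D_le _ (subspaceZ sM 2^-1%:C (subspaceD sM Mm Mm')).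
  lra.
have [|p hp] := cauchy_tends (u := u).
  move=> e e0; pose N := Num.truncn (4 / e ^+ 2); exists N => m n hm hn.
  have hN k : (N <= k)%N -> nm (x - u k) ^+ 2 < D + N.+1%:R^-1.
    move=> hk; have [_ h] := hu k; apply: (lt_le_trans h); rewrite lerD2l.
    by rewrite lef_pV2 ?posrE ?ltr0n // ler_nat ltnS.
  have := near_min _ _ N.+1%:R^-1 (hu m).1 (hu n).1 (hN m hm) (hN n hn) => h.
  rewrite -ltr_sqr ?nnegrE ?nm_ge0 ?(ltW e0) //; apply: (le_lt_trans h).
  rewrite ltr_pdivrMr ?ltr0n // mulrC -ltr_pdivrMr ?exprn_gt0 //.
  exact: truncnS_gt.
have Mp : M p.
  by move/closed_adherent: cM; apply; apply: tends_adherent hp => n; case: (hu n).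
exists p => // m Mm.
have min_p : nm (x - p) ^+ 2 <= D.
  apply/ler_addgt0Pr => e e0.
  have step d : 0 < d -> nm (x - p) ^+ 2 <= D + d + 2 * d * nm (x - p).
    move=> d0; have [N hN] := hp d d0.
    pose K := maxn N (Num.truncn d^-1).
    have h1 : nm (p - u K) < d by apply: hN; rewrite leq_maxl.
    have h2 : nm (x - u K) ^+ 2 < D + d.
      apply: (lt_le_trans (hu K).2); rewrite lerD2l.
      rewrite -[leRHS]invrK lef_pV2 ?posrE ?invr_gt0 ?ltr0n //.
      apply: (le_trans (ltW (truncnS_gt _))).
      by rewrite ler_nat ltnS leq_maxr.
    have h3 := nm_dist x (u K) p; rewrite (nmBC (u K)) in h3.
    have a0 := nm_ge0 (x - p); have b0 := nm_ge0 (p - u K).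
    have c0 := sqr_ge0 (nm (x - u K)).
    have h5 : nm (p - u K) * nm (x - p) <= d * nm (x - p).
      by rewrite ler_wpM2r // ltW.
    have [h4|h4] := leP (nm (x - p)) (nm (p - u K)).
      have : nm (x - p) * nm (x - p) <= nm (p - u K) * nm (x - p).
        by rewrite ler_wpM2r.
      by have := sqr_ge0 (nm (x - p)); rewrite expr2; lra.
    have : (nm (x - p) - nm (p - u K)) ^+ 2 <= nm (x - u K) ^+ 2.
      by rewrite ler_sqr ?nnegrE ?nm_ge0 //; lra.
    by have := sqr_ge0 (nm (p - u K)); nra.
  pose d := e / (1 + 2 * nm (x - p)).
  have q0 : 0 < 1 + 2 * nm (x - p) by have := nm_ge0 (x - p); lra.
  have d0 : 0 < d by rewrite divr_gt0.
  have := step _ d0; have : d * (1 + 2 * nm (x - p)) = e by rewrite /d divfK ?gt_eqF.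
  nra.
have hmin c : nm (x - p) ^+ 2 <= nm (x - p - c *: m) ^+ 2.
  apply: (le_trans min_p); rewrite -addrA -opprD; apply: D_le.
  by apply: subspaceD => //; apply: subspaceZ.
have [m0|m0] := eqVneq m 0; first by rewrite m0 dot0l.
have nm2 : 0 < nm m ^+ 2 by rewrite exprn_gt0 // lt_def nm_eq0 m0 nm_ge0.
have nz : (nm m ^+ 2)%:C != 0 by rewrite realC_eq0 gt_eqF.
(* c m is the projection of x - p on the line of m: by Pythagoras removing it
   would shorten x - p unless c = 0 *)
pose c := dot (x - p) m / (nm m ^+ 2)%:C.
have o : dot (x - p - c *: m) (c *: m) = 0.
  by rewrite dotZr dotBl dotZl dotxx /c divfK // subrr mulr0.
have := pythagoras o; rewrite subrK => P.
have /eqP : nm (c *: m) ^+ 2 = 0.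
  apply/eqP; rewrite eq_le sqr_ge0 andbT.
  by have := hmin c; lra.
rewrite sqrf_eq0 nm_eq0 scaler_eq0 (negPf m0) orbF mulf_eq0 invr_eq0 (negPf nz) orbF.
by move=> /eqP h; rewrite dotC h conjc0.
Qed.

Lemma adherent_subspace M : subspace_of M -> closed_subspace (adherent M).
Proof.
move=> sM; split; first split.
- by move=> e e0; exists 0; [case: sM | rewrite subr0 nm0].
- move=> a x y hx hy e e0.
  have d0 : 0 < e / (cn a + 1) / 2.
    by rewrite !divr_gt0 // ltr_wpDl ?cn_ge0.
  have [u Mu hu] := hx _ d0.
  have [v Mv hv] : exists2 v, M v & nm (y - v) < e / 2 by apply: hy; rewrite divr_gt0.
  exists (a *: u + v); first by case: sM => _; apply.
  rewrite opprD addrACA -scalerBr.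
  apply: (le_lt_trans (nmD _ _)); rewrite nmZ.
  have c1 : 0 < cn a + 1 by rewrite ltr_wpDl ?cn_ge0.
  have : nm (x - u) * (cn a + 1) < e / 2.
    by rewrite -ltr_pdivlMr // mulrAC.
  by have := nm_ge0 (x - u); have := cn_ge0 a; nra.
apply/closed_adherent => x hx e e0.
have e2 : 0 < e / 2 by rewrite divr_gt0.
have [u hu n1] := hx _ e2; have [v Mv n2] := hu _ e2.
by exists v => //; apply: (le_lt_trans (nm_dist _ u _)); lra.
Qed.

Lemma orth0_dense M : subspace_of M -> orth dot M = [set 0] -> forall x, adherent M x.
Proof.
move=> sM o x.
have [p hp] := projection_exists (adherent_subspace sM) x.
move=> h; suff -> : x = p by [].
apply/subr0_eq; have : orth dot M (x - p).
  by move=> u Mu; apply: h => e e0; exists u => //; rewrite subrr nm0.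
by rewrite o.
Qed.

Definition proj M x : H := xget 0 [set p | M p /\ orth dot M (x - p)].

Lemma projP M : closed_subspace M ->
  forall x, M (proj M x) /\ orth dot M (x - proj M x).
Proof.
move=> cM x; have [p Mp op] := projection_exists cM x.
exact: (xgetPex 0 (P := [set p | M p /\ orth dot M (x - p)]) (ex_intro _ p (conj Mp op))).
Qed.

Lemma projU M : closed_subspace M -> forall x p, M p -> orth dot M (x - p) ->
  proj M x = p.
Proof.
move=> cM x p Mp op; have [Mq oq] := projP cM x.
apply/subr0_eq/dotxx0.
have MD : M (proj M x - p) by apply: subspaceB => //; case: cM.
have -> : dot (proj M x - p) (proj M x - p) =
  dot (proj M x - p) (x - p) - dot (proj M x - p) (x - proj M x).
  by rewrite -dotBr opprB [x - p + _]addrC subrKA.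
by rewrite op // oq // subrr.
Qed.

Lemma proj_linear M : closed_subspace M -> forall a x y,
  proj M (a *: x + y) = a *: proj M x + proj M y.
Proof.
move=> cM a x y; have [Mx ox] := projP cM x; have [My oy] := projP cM y.
have [sO _] := orth_closed_subspace M.
apply: (projU cM); first by case: cM => -[_ h _]; apply: h.
by rewrite opprD addrACA -scalerBr; case: sO => _; apply.
Qed.

Lemma proj_id M : closed_subspace M -> forall x, M x -> proj M x = x.
Proof. by move=> cM x Mx; apply: projU => // u _; rewrite subrr dot0r. Qed.

Lemma nm_proj M : closed_subspace M -> forall x, nm (proj M x) <= nm x.
Proof.
move=> cM x; have [Mx ox] := projP cM x.
rewrite -ler_sqr ?nnegrE ?nm_ge0 //.
have -> : nm x ^+ 2 = nm (proj M x) ^+ 2 + nm (x - proj M x) ^+ 2.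
  by rewrite -pythagoras ?ox // addrC subrK.
by rewrite lerDl sqr_ge0.
Qed.

End HilbertSpace.
Arguments proj {R H} dot M x.

(** * Symmetric and selfadjoint operators, resolvents *)

Section Operators.
Context {R : realType} {H : completeNormedModType R[i]}.
Context {dot : {dot H for Num.conj}} (hH : hilbert dot).
Implicit Types (x y u v f g : H) (z w : R[i]) (M : set H) (S T : set (H * H)).

Lemma opD T : subspace_of T -> forall x y x' y',
  T (x, y) -> T (x', y') -> T (x + x', y + y').
Proof. by move=> sT x y x' y' h h'; exact: (subspaceD sT h h'). Qed.

Lemma opB T : subspace_of T -> forall x y x' y',
  T (x, y) -> T (x', y') -> T (x - x', y - y').
Proof. by move=> sT x y x' y' h h'; exact: (subspaceB sT h h'). Qed.

Lemma opZ T : subspace_of T -> forall a x y, T (x, y) -> T (a *: x, a *: y).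
Proof. by move=> sT a x y h; exact: (subspaceZ sT a h). Qed.

Lemma ran_subspace T z : subspace_of T -> subspace_of (ran T z).
Proof.
move=> sT; split; first by exists 0; [case: sT | rewrite /= scaler0 subr0].
move=> a _ _ [p Tp <-] [q Tq <-]; exists (a *: p + q); first by case: sT => _; apply.
by rewrite /= scalerBr scalerDr !scalerA opprD addrACA mulrC.
Qed.

(** If (T - z) x_n converges, the lower bound makes x_n a Cauchy sequence, and the
    closedness of T identifies the limit as a value of T - z. *)
Lemma bounded_below_ran_closed T z (c : R) : closed T -> subspace_of T ->
  (forall x y, T (x, y) -> nm x <= c * nm (y - z *: x)) -> closed (ran T z).
Proof.
move=> /closed_adherent2 cT sT hc; apply/closed_adherent => w hw.
wlog c0 : c hc / 0 < c.
  move=> h; apply: (h (Num.max c 1)); last by rewrite lt_max ltr01 orbT.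
  move=> x y Txy; apply: (le_trans (hc _ _ Txy)).
  by rewrite ler_wpM2r ?nm_ge0 // le_max lexx.
have ex n : exists p, T p /\ nm (w - (p.2 - z *: p.1)) < n.+1%:R^-1.
  by have [|_ [p Tp <-] hp] := hw n.+1%:R^-1; [rewrite invr_gt0 | exists p].
have [u hu] := choice ex.
have small e : 0 < e -> exists N, forall n, (N <= n)%N ->
    nm (w - ((u n).2 - z *: (u n).1)) < e.
  move=> e0; exists (Num.truncn e^-1) => n hn; apply: (lt_le_trans (hu n).2).
  rewrite -[leRHS]invrK lef_pV2 ?posrE ?invr_gt0 ?ltr0n //.
  by apply: (le_trans (ltW (truncnS_gt _))); rewrite ler_nat ltnS.
have [|x hx] := cauchy_tends (u := fun n => (u n).1).
  move=> e e0; have [|N hN] := small (e / c / 2); first by rewrite !divr_gt0.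
  exists N => m n hm hn.
  have Tmn := opB sT (x := (u m).1) (y := (u m).2) (x' := (u n).1) (y' := (u n).2).
  have /hc := Tmn ltac:(by rewrite -surjective_pairing; case: (hu m))
                  ltac:(by rewrite -surjective_pairing; case: (hu n)).
  move=> h; apply: (le_lt_trans h).
  rewrite mulrC -ltr_pdivlMr // scalerBr opprB addrACA.
  have -> : (u m).2 + z *: (u n).1 + (- (u n).2 - z *: (u m).1) =
    (w - ((u n).2 - z *: (u n).1)) - (w - ((u m).2 - z *: (u m).1)).
    rewrite !opprB [RHS]addrC [in RHS]addrA subrK addrC.
    by rewrite [- (u n).2 - _]addrC addrACA addrC.
  apply: (le_lt_trans (nmD _ _)); rewrite nmN.
  by have := hN m hm; have := hN n hn; lra.
exists (x, w + z *: x); last by rewrite /= addrK.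
apply: cT => e e0.
have d0 : 0 < e / 2 / (cn z + 1) by rewrite !divr_gt0 // ltr_wpDl ?cn_ge0.
have [N1 h1] := hx _ d0.
have [N2 h2] := small (e / 2) (divr_gt0 e0 (ltr0n _ 2)).
have k1 := h1 _ (leq_maxl N1 N2); have k2 := h2 _ (leq_maxr N1 N2).
have c1 : 0 < cn z + 1 by rewrite ltr_wpDl ?cn_ge0.
have k3 : nm (x - (u (maxn N1 N2)).1) * (cn z + 1) < e / 2 by rewrite -ltr_pdivlMr.
exists (u (maxn N1 N2)); split; first by case: (hu (maxn N1 N2)).
  apply: (le_lt_trans (y := nm (x - (u (maxn N1 N2)).1) * (cn z + 1))); last lra.
  by rewrite ler_peMr ?nm_ge0 // lerDr cn_ge0.
set b := (u _).2 in k2 *; set a := (u _).1 in k1 k2 k3 *.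
have -> : w + z *: x - b = (w - (b - z *: a)) + z *: (x - a).
  rewrite opprB scalerBr -!addrA; congr (w + _).
  by rewrite [RHS]addrC -!addrA addNr addr0 addrC.
apply: (le_lt_trans (nmD _ _)); rewrite nmZ.
by have := nm_ge0 (x - a); nra.
Qed.

Lemma adjoint_subspace M T : subspace_of M -> subspace_of (adjoint dot M T).
Proof.
move=> sM; have [M0 MP] := sM; split.
  by split => //= q _; rewrite !dot0r.
move=> a [x y] [x' y'] [/= Mx My h] [/= Mx' My' h'].
split; rewrite /=; [exact: MP | exact: MP |] => q Tq.
by rewrite !dotDr !dotZr h // h'.
Qed.

Lemma adjoint_closed T : closed (adjoint dot setT T).
Proof.
apply/closed_adherent2 => x y hxy; split => // q Tq /=.
apply/subr0_eq/eqP; rewrite -cn_eq0 eq_le cn_ge0 andbT.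
apply/ler_addgt0Pr => e e0; rewrite add0r.
pose K := nm q.1 + nm q.2 + 1.
have K0 : 0 < K by rewrite /K; have := nm_ge0 q.1; have := nm_ge0 q.2; lra.
have [|[u v] /= [[_ _ /(_ _ Tq) /= h] n1 n2]] := hxy (e / K); first by rewrite divr_gt0.
have -> : dot q.2 x - dot q.1 y = dot q.2 (x - u) - dot q.1 (y - v).
  by rewrite !dotBr h opprB addrA subrK.
apply: (le_trans (cnD _ _)); rewrite cnN.
have d1 : nm (x - u) * K <= e by rewrite -ler_pdivlMr // ltW.
have d2 : nm (y - v) * K <= e by rewrite -ler_pdivlMr // ltW.
have m1 := cauchy_schwarz hH q.2 (x - u); have m2 := cauchy_schwarz hH q.1 (y - v).
have e1 : nm (x - u) <= e / K by rewrite ltW.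
have e2 : nm (y - v) <= e / K by rewrite ltW.
have p1 : nm q.2 * nm (x - u) <= nm q.2 * (e / K) by rewrite ler_wpM2l ?nm_ge0.
have p2 : nm q.1 * nm (y - v) <= nm q.1 * (e / K) by rewrite ler_wpM2l ?nm_ge0.
have t0 : 0 < e / K by rewrite divr_gt0.
have : K * (e / K) = e by rewrite mulrC divfK // gt_eqF.
by move: (e / K) t0 p1 p2 => t t0 p1 p2; rewrite /K; lra.
Qed.

Lemma orth_ran T z : orth dot (ran T z) = ker (adjoint dot setT T) z^*%C.
Proof.
apply/seteqP; split=> x h.
  split => // q Tq /=; have := h _ (ex_intro2 _ _ q Tq erefl).
  by rewrite dotBl dotZl dotZr conjcK => /subr0_eq.
move=> _ [q Tq <-]; have [_ _ /(_ _ Tq) /=] := h.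
by rewrite dotBl dotZl dotZr conjcK => ->; rewrite subrr.
Qed.

Lemma symmetric_real T x y : symmetric_operator dot T -> T (x, y) ->
  complex.Im (dot y x) = 0.
Proof.
move=> [_ hT] Txy; have [_ _ /(_ _ Txy) /=] := hT _ Txy.
rewrite [dot x y]dotC; case: (dot y x) => a b /= [] /eqP; rewrite -addr_eq0 -mulr2n.
by rewrite mulrn_eq0 /= => /eqP.
Qed.

(** Since <T x, x> is real, the imaginary part of <(T - z) x, x> is -Im z |x|^2. *)
Lemma symmetric_bound T z x y : symmetric_operator dot T -> T (x, y) ->
  `|complex.Im z| * nm x <= nm (y - z *: x).
Proof.
move=> hT Txy; have [->|x0] := eqVneq x 0; first by rewrite nm0 mulr0 nm_ge0.
have nx : 0 < nm x by rewrite lt_def nm_eq0 x0 nm_ge0.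
rewrite -(ler_pM2r nx); apply: (le_trans _ (cauchy_schwarz hH _ _)).
apply: le_trans (Im_le_cn _); rewrite dotBl dotZl dotxx //.
have := symmetric_real hT Txy; case: (dot y x) => p q /= ->.
case: z => c d /=; rewrite mulr0 !add0r normrN normrM -mulrA.
by rewrite [X in _ <= _ * X]ger0_norm ?sqr_ge0 // expr2.
Qed.

Lemma symmetric_ran_closed T z : symmetric_operator dot T -> closed T ->
  complex.Im z != 0 -> closed (ran T z).
Proof.
move=> hT cT z0; have [[sT _] _] := hT.
apply: (bounded_below_ran_closed (c := `|complex.Im z|^-1)) => // x y Txy.
by rewrite mulrC ler_pdivlMr ?normr_gt0 // mulrC; apply: symmetric_bound hT Txy.
Qed.

Lemma densely_definedP T : densely_defined setT T <-> forall x, adherent (dom T) x.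
Proof.
by split=> [h x|h x _]; apply/closure_nm => //; apply: h.
Qed.

Lemma dense_symmetric_operator T : densely_defined setT T -> subspace_of T ->
  T `<=` adjoint dot setT T -> symmetric_operator dot T.
Proof.
move=> /densely_definedP dT sT hT; split => //; split => // x y y' h h'.
apply/subr0_eq/(dot_dense0 hH dT) => u [v Tuv].
have := opB sT h h'; rewrite subrr => /hT [_ _ /(_ _ Tuv) /=].
by rewrite dot0r.
Qed.

(** A symmetric operator whose shifts by +-i are onto has no room for a larger
   adjoint: a vector of the domain of the adjoint differs from one of the
   domain by a vector orthogonal to the range of T + i. *)
Lemma selfadjoint_of_ran T : densely_defined setT T -> subspace_of T ->
  T `<=` adjoint dot setT T -> ran T 'i = setT -> ran T (- 'i) = setT ->
  selfadjoint dot setT T.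
Proof.
move=> dT sT hT r1 r2; split => //.
  by case: (dense_symmetric_operator dT sT hT).
apply/seteqP; split => // -[x y] h.
have : ran T 'i (y - 'i *: x) by rewrite r1.
case=> -[x' y'] /= Tx' E.
have sA : subspace_of (adjoint dot setT T) by exact: adjoint_subspace.
have hB := opB sA h (hT _ Tx').
have yE : y - y' = 'i *: (x - x').
  have -> : y = y' - 'i *: x' + 'i *: x by rewrite E subrK.
  by rewrite scalerBr addrC -addrA addKr addrC.
have x0 : x - x' = 0.
  apply: (dotxx0 hH); have : orth dot (ran T (- 'i)) (x - x').
    rewrite orth_ran (_ : (- 'i)^*%C = 'i); first by rewrite /ker /= -yE.
    by apply/eqP; rewrite eq_complex /= oppr0 opprK !eqxx.
  by rewrite r2; apply.
by move: yE; rewrite x0 scaler0 => /subr0_eq ->; move/subr0_eq: x0 => ->.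
Qed.

Section SelfAdjoint.
Variable T : set (H * H).
Hypothesis saT : selfadjoint dot setT T.

Lemma sa_symmetric : symmetric_operator dot T.
Proof. by case: saT => oT _ E; split => //; rewrite -E. Qed.

Lemma sa_subspace : subspace_of T.
Proof. by case: saT => -[]. Qed.

Lemma sa_closed : closed T.
Proof. by case: saT => _ _ ->; exact: adjoint_closed. Qed.

Lemma sa_fun x y y' : T (x, y) -> T (x, y') -> y = y'.
Proof. by case: saT => -[_ h] _ _; apply: h. Qed.

Lemma sa_sym x y x' y' : T (x, y) -> T (x', y') -> dot y x' = dot x y'.
Proof. by move=> h h'; case: saT => _ _ E; move: h'; rewrite {1}E => -[_ _ /(_ _ h)]. Qed.

Lemma sa_bound z x y : T (x, y) -> `|complex.Im z| * nm x <= nm (y - z *: x).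
Proof. by move=> h; apply: symmetric_bound h; exact: sa_symmetric. Qed.

(** The range is closed by [symmetric_bound], and a vector orthogonal to it would be
    an eigenvector of T for a nonreal eigenvalue. *)
Lemma sa_ran z : complex.Im z != 0 -> ran T z = setT.
Proof.
move=> z0; apply/seteqP; split => // w _.
have cr := symmetric_ran_closed sa_symmetric sa_closed z0.
move/closed_adherent: cr; apply.
apply: (orth0_dense hH (ran_subspace z sa_subspace)).
apply/seteqP; split => [x|x ->]; last by move=> u _; rewrite dot0r.
rewrite orth_ran; case: saT => _ _ <- h.
have := sa_bound z^*%C h; rewrite subrr nm0 => hx.
apply/eqP; rewrite -nm_eq0 eq_le nm_ge0 andbT.
have : 0 < `|complex.Im z^*%C| 
  by rewrite normr_gt0; case: (z) z0 => a b /=; rewrite oppr_eq0.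
by move=> /pmulr_rle0 <-.
Qed.

(** The resolvent (T - z)^-1, for nonreal z. *)
Definition res z f : H := xget 0 [set x | T (x, f + z *: x)].

Lemma resP z f : complex.Im z != 0 -> T (res z f, f + z *: res z f).
Proof.
move=> z0; have : ran T z f by rewrite sa_ran.
case=> -[x y] /= Txy E; apply: (xgetPex 0 (P := [set x | T (x, f + z *: x)])).
by exists x; rewrite /= -E subrK.
Qed.

Lemma resU z x y : complex.Im z != 0 -> T (x, y) -> res z (y - z *: x) = x.
Proof.
move=> z0 h; have := opB sa_subspace (resP (y - z *: x) z0) h.
set r := res _ _ => h'; apply/subr0_eq/eqP; rewrite -nm_eq0 eq_le nm_ge0 andbT.
have := sa_bound z h'.
have -> : y - z *: x + z *: r - y - z *: (r - x) = 0.
  by rewrite scalerBr -[y - _ + _]addrA [y + _]addrC addrK [- _ + _]addrC subrr.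
by rewrite nm0 pmulr_rle0 // normr_gt0.
Qed.

Lemma res_eq z x f : complex.Im z != 0 -> T (x, f + z *: x) -> res z f = x.
Proof. by move=> z0 h; rewrite -[in LHS](addrK (z *: x) f) resU. Qed.

Lemma res_linear z : complex.Im z != 0 -> forall a f g,
  res z (a *: f + g) = a *: res z f + res z g.
Proof.
move=> z0 a f g; apply: res_eq => //.
have := opD sa_subspace (opZ sa_subspace a (resP f z0)) (resP g z0).
by rewrite !scalerDr !scalerA [a * z]mulrC addrACA.
Qed.

Lemma resD z f g : complex.Im z != 0 -> res z (f + g) = res z f + res z g.
Proof. by move=> z0; rewrite -[f]scale1r res_linear // !scale1r. Qed.

Lemma resZ z a f : complex.Im z != 0 -> res z (a *: f) = a *: res z f.
Proof.
move=> z0; have r0 : res z 0 = 0.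
  by apply: res_eq => //; rewrite scaler0 addr0; case: sa_subspace.
by rewrite -[a *: f]addr0 res_linear // r0 addr0.
Qed.

Lemma resB z f g : complex.Im z != 0 -> res z (f - g) = res z f - res z g.
Proof. by move=> z0; rewrite -scaleN1r resD // resZ // scaleN1r. Qed.

Lemma nm_res z f : complex.Im z != 0 -> `|complex.Im z| * nm (res z f) <= nm f.
Proof. by move=> z0; have := sa_bound z (resP f z0); rewrite addrK. Qed.

Lemma res_adj z f g : complex.Im z != 0 -> dot (res z f) g = dot f (res z^*%C g).
Proof.
move=> z0; have z1 : complex.Im z^*%C != 0 by case: (z) z0 => a b; rewrite /= oppr_eq0.
have := sa_sym (resP f z0) (resP g z1).
by rewrite dotDl dotDr dotZl dotZr conjcK => /addIr.
Qed.

Lemma res_res z w f : complex.Im z != 0 -> complex.Im w != 0 ->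
  res z f - res w f = (z - w) *: res z (res w f).
Proof.
move=> z0 w0.
have E : res z f + (w - z) *: res z (res w f) = res w f.
  by rewrite -resZ // -resD // scalerBl addrA resU //; exact: resP.
by rewrite -[X in _ - X = _]E opprD addrA subrr add0r -scaleNr opprB.
Qed.

Lemma resC z w f : complex.Im z != 0 -> complex.Im w != 0 ->
  res z (res w f) = res w (res z f).
Proof.
move=> z0 w0; have [->//|zw] := eqVneq z w.
have zw' : z - w != 0 by rewrite subr_eq0.
apply: (scalerI zw'); rewrite -res_res //.
by rewrite -[z - w]opprB scaleNr -res_res // opprB.
Qed.

End SelfAdjoint.
End Operators.

(** * Positivity of rational functions of a selfadjoint operator *)

Section PositivePolynomials.
Context {R : realType}.

Definition conjp (p : {poly R[i]}) := map_poly (@conjc R) p.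

Lemma conjpM p q : conjp (p * q) = conjp p * conjp q.
Proof. exact: rmorphM. Qed.

Lemma conjpXsubC (z : R[i]) : conjp ('X - z%:P) = 'X - (z^*%C)%:P.
Proof. by rewrite /conjp rmorphB /= map_polyX map_polyC. Qed.

(** |X - (a + i b)|^2 as a real polynomial. *)
Definition quad (a b : R) : {poly R} := ('X - a%:P) ^+ 2 + (b ^+ 2)%:P.

Lemma horner_quad a b t : (quad a b).[t] = (t - a) ^+ 2 + b ^+ 2.
Proof. by rewrite /quad !hornerE. Qed.

Lemma map_quad a b : map_poly (real_complex R) (quad a b) =
  ('X - (a +i* b)%:P) * conjp ('X - (a +i* b)%:P).
Proof.
rewrite conjpXsubC /quad rmorphD rmorphXn rmorphB /= map_polyX !map_polyC /=.
have -> : (a +i* b) = a%:C + b%:C * 'i :> R[i].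
  by apply/eqP; rewrite eq_complex /=; apply/andP; split; apply/eqP; ring.
have -> : (a -i* b) = a%:C - b%:C * 'i :> R[i].
  by apply/eqP; rewrite eq_complex /=; apply/andP; split; apply/eqP; ring.
have -> : (b ^+ 2)%:C = - (b%:C * 'i) ^+ 2 :> R[i].
  by rewrite exprMn sqr_i mulrN1 opprK rmorphXn.
rewrite polyCD polyCB polyCN rmorphXn /=; ring.
Qed.

Lemma quad_gt0 a b t : b != 0 -> 0 < (quad a b).[t].
Proof.
move=> b0; rewrite horner_quad ltr_wpDl ?sqr_ge0 //.
by rewrite lt_def sqrf_eq0 b0 sqr_ge0.
Qed.

Lemma size_quad a b : size (quad a b) = 3.
Proof.
rewrite /quad size_polyDl size_exp_XsubC //.
by rewrite (leq_ltn_trans (size_polyC_leq1 _)).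
Qed.

(** The roots of r are nonreal and come in conjugate pairs; q collects one root of
    each pair. *)
Lemma positive_poly_square (r : {poly R}) : (forall t, 0 < r.[t]) ->
  exists q : {poly R[i]}, map_poly (real_complex R) r = q * conjp q.
Proof.
have [n] := ubnP (size r); elim: n r => // n IH r; rewrite ltnS => sr rpos.
have [s1|s1] := eqVneq (size r) 1.
  have /size_poly1P[c _ rc] : size r == 1 by apply/eqP.
  have c0 : 0 < c by have := rpos 0; rewrite rc hornerC.
  exists ((Num.sqrt c)%:C)%:P; rewrite rc /conjp !map_polyC -polyCM /=.
  congr (_%:P); apply/eqP; rewrite eq_complex /= oppr0 !mulr0 mul0r subr0 addr0 eqxx andbT.
  by rewrite -expr2 sqr_sqrtr ?ltW.
have rz : r != 0 by apply/eqP => h; have := rpos 0; rewrite h horner0 ltxx.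
pose p := map_poly (real_complex R) r.
have /closed_rootP[z pz] : size p != 1 by rewrite size_map_poly.
case: z pz => a b pz.
have b0 : b != 0.
  apply/eqP => b0; move: pz; rewrite b0 /root /p (horner_map _ _ a) realC_eq0.
  by rewrite gt_eqF.
have pz' : root p (a -i* b).
  have <- : map_poly conjc p = p.
    by rewrite /p -map_poly_comp; apply: eq_map_poly => c /=; rewrite oppr0.
  by rewrite complex_root_conj /= opprK.
have /dvdpP[r' rE] : quad a b %| r.
  rewrite -(dvdp_map (real_complex R)) map_quad conjpXsubC.
  have := @uniq_roots_dvdp _ p [:: a +i* b; a -i* b].
  rewrite uniq_rootsE !big_cons big_nil mulr1; apply.
    by rewrite /= pz pz'.
  rewrite /= inE andbT eq_complex /= eqxx /= -subr_eq0 opprK -mulr2n.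
  by rewrite mulrn_eq0.
have r'pos t : 0 < r'.[t].
  by have := rpos t; rewrite rE hornerM pmulr_lgt0 // quad_gt0.
have r'z : r' != 0 by apply/eqP => h; have := r'pos 0; rewrite h horner0 ltxx.
have [|q hq] := IH r' _ r'pos.
  move: sr; rewrite rE size_mul ?size_quad //; last by rewrite -size_poly_eq0 size_quad.
  by rewrite addnS /= addn2 => /ltnW/leq_trans -> //; exact: leqnn.
exists (q * ('X - (a +i* b)%:P)).
by rewrite rE rmorphM /= hq map_quad conjpM; ring.
Qed.

End PositivePolynomials.

Section Evaluation.
Context {R : realType} {V : lmodType R[i]}.
Implicit Types (e : nat -> V) (p q : {poly R[i]}).

(** With [e k] = T^k u this is p(T) u. *)
Definition pev e p : V := \sum_(k < size p) p`_k *: e k.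

Lemma pev_wide e p n : (size p <= n)%N -> pev e p = \sum_(k < n) p`_k *: e k.
Proof.
move=> h; rewrite /pev (big_ord_widen n (fun k => p`_k *: e k) h).
rewrite big_mkcond; apply: eq_bigr => k _; case: ltnP => // hk.
by rewrite nth_default // scale0r.
Qed.

Lemma pev_linear e a p q : pev e (a *: p + q) = a *: pev e p + pev e q.
Proof.
pose n := maxn (size p) (size q).
have sp : (size p <= n)%N by rewrite leq_maxl.
have sq : (size q <= n)%N by rewrite leq_maxr.
rewrite !(@pev_wide _ _ n) //; last first.
  rewrite (leq_trans (size_polyD _ _)) // geq_max sq andbT.
  exact: leq_trans (size_scale_leq _ _) sp.
rewrite scaler_sumr -big_split; apply: eq_bigr => k _ /=.
by rewrite coefD coefZ scalerDl scalerA.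
Qed.

Lemma pevD e p q : pev e (p + q) = pev e p + pev e q.
Proof. by rewrite -[p]scale1r pev_linear !scale1r. Qed.

Lemma pev0 e : pev e 0 = 0.
Proof. by rewrite /pev size_poly0 big_ord0. Qed.

Lemma pevZ e a p : pev e (a *: p) = a *: pev e p.
Proof. by rewrite -[a *: p]addr0 pev_linear pev0 addr0. Qed.

Lemma pev_sum e n (F : 'I_n -> {poly R[i]}) :
  pev e (\sum_(i < n) F i) = \sum_(i < n) pev e (F i).
Proof. exact: (big_morph (pev e) (pevD e) (pev0 e)). Qed.

Lemma pev_shift e p : pev e ('X * p) = pev (fun k => e k.+1) p.
Proof.
rewrite (@pev_wide _ _ (size p).+1); last first.
  by rewrite (leq_trans (size_polyMleq _ _)) // size_polyX.
rewrite big_ord_recl coefXM eqxx scale0r add0r.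
by apply: eq_bigr => k _; rewrite coefXM /=.
Qed.

Lemma pev_shiftn e n p : pev e ('X^n * p) = pev (fun k => e (n + k)%N) p.
Proof.
elim: n e => [|n IH] e; first by rewrite mul1r.
by rewrite exprS -mulrA pev_shift IH.
Qed.

Lemma pev1 e : pev e 1 = e 0.
Proof. by rewrite /pev size_poly1 big_ord_recl big_ord0 coef1 scale1r addr0. Qed.

End Evaluation.

Section Moments.
Context {R : realType} {H : completeNormedModType R[i]}.
Context {dot : {dot H for Num.conj}} (hH : hilbert dot).
Variable T : set (H * H).
Hypothesis saT : selfadjoint dot setT T.
Implicit Types (e : nat -> H) (p q : {poly R[i]}) (z : R[i]) (f : H).

Definition chain N e := forall k, (k < N)%N -> T (e k, e k.+1).

Lemma chain_pev N e p : chain N e -> (size p <= N)%N -> T (pev e p, pev e ('X * p)).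
Proof.
move=> he sp; rewrite pev_shift /pev; have sT := sa_subspace saT.
elim/big_rec2: _ => [|k x y _ h]; first by case: sT.
by apply: opD => //; apply: opZ => //; apply: he; apply: leq_trans sp.
Qed.

(** Applying one more resolvent: T u' = u + z u' for u' = (T - z)^-1 u, so the powers
    T^k u' satisfy the recursion e'_(k+1) = e_k + z e'_k. *)
Lemma chain_extend N e z : complex.Im z != 0 -> chain N e ->
  exists e', chain N.+1 e' /\ forall p, pev e' (('X - z%:P) * p) = pev e p.
Proof.
move=> z0 he.
pose e' := fix e' k := if k is j.+1 then e j + z *: e' j else res T z (e 0).
exists e'; split.
  elim=> [_|k IH]; first exact: (resP hH saT).
  rewrite ltnS => hk; have h := IH (ltnW hk).
  exact: (opD (sa_subspace saT) (he _ hk) (opZ (sa_subspace saT) z h)).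
move=> p; rewrite mulrBl pevD pev_shift -scaleN1r pevZ mul_polyC pevZ scaleN1r.
rewrite /pev scaler_sumr -sumrB; apply: eq_bigr => k _ /=.
by rewrite scalerDr !scalerA [z * _]mulrC addrK.
Qed.

(** Every vector is P(T) u for a suitable u in the domain of T^N, when P is a
   product of N factors X - z with nonreal z: apply N resolvents. *)
Lemma chain_exists n (z : 'I_n -> R[i]) f : (forall i, complex.Im (z i) != 0) ->
  exists e, chain n e /\ pev e (\prod_(i < n) ('X - (z i)%:P)) = f.
Proof.
elim: n z => [|n IH] z hz.
  by exists (fun=> f); split => //; rewrite big_ord0 pev1.
have [e [he hf]] := IH (fun i => z (lift ord0 i)) (fun i => hz _).
have [e' [he' hp]] := chain_extend (hz ord0) he.
by exists e'; split => //; rewrite big_ord_recl hp.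
Qed.

Lemma chain_res N e z p q : complex.Im z != 0 -> chain N e -> (size q <= N)%N ->
  p = ('X - z%:P) * q -> res T z (pev e p) = pev e q.
Proof.
move=> z0 he sq ->; apply: (res_eq hH saT) => //.
rewrite -pevZ -pevD -mul_polyC -mulrDl subrK; exact: chain_pev he sq.
Qed.

Lemma chain_hankel N e i j : chain N e -> (i <= N)%N -> (j <= N)%N ->
  forall t, (t <= j)%N -> (i + t <= N)%N ->
  dot (e i) (e j) = dot (e (i + t)%N) (e (j - t)%N).
Proof.
move=> he hi hj; elim=> [|t IH] ht hit; first by rewrite addn0 subn0.
rewrite IH ?(ltnW ht) //; last by rewrite (leq_trans _ hit) // addnS.
have h1 : T (e (i + t)%N, e (i + t.+1)%N) by rewrite addnS; apply: he; rewrite -addnS.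
have h2 : T (e (j - t.+1)%N, e (j - t)%N).
  rewrite (_ : j - t = (j - t.+1).+1)%N; last by rewrite subnSK.
  by apply: he; rewrite (leq_trans _ hj) // subnSK // leq_subr.
by rewrite (sa_sym saT h1 h2).
Qed.

(** Since T is symmetric, <T^i u, T^j u> depends only on i + j; hence
   <p(T) u, q(T) u> is a linear functional of the polynomial p q^*. *)
Lemma moment_functional N e : chain N e -> exists m : nat -> R[i]^o,
  forall p q, (size p <= N.+1)%N -> (size q <= N.+1)%N ->
  dot (pev e p) (pev e q) = pev m (p * conjp q).
Proof.
move=> he; pose m k : R[i]^o := dot (e (minn k N)) (e (k - minn k N)%N).
have hm i j : (i <= N)%N -> (j <= N)%N -> dot (e i) (e j) = m (i + j)%N.
  move=> hi hj; rewrite /m.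
  have hi' : (i <= minn (i + j) N)%N by rewrite leq_min leq_addr.
  have := chain_hankel he hi hj (t := (minn (i + j) N - i)%N).
  rewrite subnKC // => ->; last exact: geq_minr.
    congr (dot _ (e _)); rewrite subnBA // addnC //.
  by rewrite leq_subLR geq_minl.
exists m => p q sp sq.
rewrite [in RHS](_ : p = \sum_(i < N.+1) p`_i *: 'X^i); last first.
  rewrite -poly_def; apply/polyP => k; rewrite coef_poly; case: ltnP => // hk.
  by rewrite nth_default // (leq_trans sp).
rewrite mulr_suml pev_sum (pev_wide _ sp) dot_suml; apply: eq_bigr => i _.
rewrite dotZl -scalerAl pevZ; congr (_ * _).
rewrite pev_shiftn (pev_wide _ sq) dot_sumr (@pev_wide _ _ _ _ N.+1); last first.
  by rewrite size_map_poly.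
apply: eq_bigr => j _; rewrite dotZr coef_map hm // -ltnS //.
Qed.

(** The spectral theorem for one class of functions: a linear combination of the functions
    1 and |t - z_i|^-2 that is positive on the real line takes a nonnegative value
    at T. Write f = P(T) u with P the product of the factors X - z_i; the polynomial
    |P|^2 (w0 + sum_i w_i |X - z_i|^-2) is positive, hence of the form q q^*, and
    the moment functional turns this identity into the claim, the left-hand side
    being |q(T) u|^2. *)
Lemma spectral_pos_strict n (a b w : 'I_n -> R) (w0 : R) f :
  (forall i, b i != 0) ->
  (forall t, 0 < w0 + \sum_(i < n) w i / ((t - a i) ^+ 2 + b i ^+ 2)) ->
  0 <= w0 * nm f ^+ 2 + \sum_(i < n) w i * nm (res T (a i +i* b i) f) ^+ 2.
Proof.
move=> hb hpos; pose z i := a i +i* b i.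
have [e [he hf]] := chain_exists f (hb : forall i, complex.Im (z i) != 0).
set P := \prod_(i < n) _ in hf; pose Q i := \prod_(j < n | j != i) ('X - (z j)%:P).
have PQ i : P = ('X - (z i)%:P) * Q i by rewrite /P (bigD1 i).
have sP : size P = n.+1 by rewrite /P -big_enum /= size_prod_XsubC size_enum_ord.
have sQ i : (size (Q i) <= n)%N.
  have := sP; rewrite (PQ i) size_mul ?polyXsubC_eq0 //; last first.
    by apply/eqP => h; have := sP; rewrite (PQ i) h mulr0 size_poly0.
  by rewrite size_XsubC /= => -[<-].
pose G := \prod_(j < n) quad (a j) (b j).
pose Gi i := \prod_(j < n | j != i) quad (a j) (b j).
pose r := w0 *: G + \sum_(i < n) w i *: Gi i.
have mG : map_poly (real_complex R) G = P * conjp P.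
  rewrite /P /G /conjp !rmorph_prod -big_split; apply: eq_bigr => j _ /=.
  exact: map_quad.
have mGi i : map_poly (real_complex R) (Gi i) = Q i * conjp (Q i).
  rewrite /Q /Gi /conjp !rmorph_prod -big_split; apply: eq_bigr => j _ /=.
  exact: map_quad.
have rpos t : 0 < r.[t].
  have -> : r.[t] = G.[t] * (w0 + \sum_(i < n) w i / ((t - a i) ^+ 2 + b i ^+ 2)).
    rewrite /r hornerD hornerZ mulrDr mulrC; congr (_ + _).
    rewrite horner_sum mulr_sumr; apply: eq_bigr => i _.
    rewrite hornerZ -horner_quad /G (bigD1 i) //= hornerM.
    rewrite mulrC [_ * (Gi i).[t]]mulrC -mulrA; congr (_ * _).
    by rewrite mulrC divfK // gt_eqF // quad_gt0.
  rewrite mulr_gt0 // /G horner_prod prodr_gt0 // => j _; exact: quad_gt0.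
have [q hq] := positive_poly_square rpos.
have mr : map_poly (real_complex R) r =
    w0%:C *: (P * conjp P) + \sum_(i < n) (w i)%:C *: (Q i * conjp (Q i)).
  rewrite /r rmorphD rmorph_sum /= map_polyZ mG; congr (_ + _).
  by apply: eq_bigr => i _; rewrite map_polyZ mGi.
have sq : (size q <= n.+1)%N.
  have s1 : (size (q * conjp q)%R <= n.+1 + n)%N.
    rewrite -hq mr (leq_trans (size_polyD _ _)) // geq_max; apply/andP; split.
      rewrite (leq_trans (size_scale_leq _ _)) // (leq_trans (size_polyMleq _ _)) //.
      by rewrite size_map_poly sP addnS.
    rewrite (leq_trans (size_sum _ _ _)) //; apply/bigmax_leqP => i _.
    rewrite (leq_trans (size_scale_leq _ _)) // (leq_trans (size_polyMleq _ _)) //.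
    rewrite size_map_poly (leq_trans (leq_pred _)) // leq_add //.
    by rewrite (leq_trans (sQ i)).
  have [->|q0] := eqVneq q 0; first by rewrite size_poly0.
  move: s1; rewrite size_mul ?map_poly_eq0 // size_map_poly.
  by move: (size q) => k; lia.
have [m hm] := moment_functional he.
have E : (w0 * nm f ^+ 2 + \sum_(i < n) w i * nm (res T (z i) f) ^+ 2)%:C
   = (nm (pev e q) ^+ 2)%:C.
  rewrite -(dotxx hH) hm // -hq mr pevD pevZ pev_sum rmorphD rmorph_sum /=.
  congr (_ + _).
    by rewrite rmorphM /= -(dotxx hH) -hf hm ?sP.
  apply: eq_bigr => i _; rewrite pevZ rmorphM /= -(dotxx hH) -hf.
  by rewrite (chain_res (hb i : complex.Im (z i) != 0) he (sQ i) (PQ i))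
    hm // (leq_trans (sQ i)).
by move/complexI: E => ->; rewrite sqr_ge0.
Qed.

(** The non-strict version follows by adding a small constant to w0. *)
Lemma spectral_pos n (a b w : 'I_n -> R) (w0 : R) f :
  (forall i, b i != 0) ->
  (forall t, 0 <= w0 + \sum_(i < n) w i / ((t - a i) ^+ 2 + b i ^+ 2)) ->
  0 <= w0 * nm f ^+ 2 + \sum_(i < n) w i * nm (res T (a i +i* b i) f) ^+ 2.
Proof.
move=> hb hpos; set S := \sum_(i < n) _.
apply/ler_addgt0Pr => e e0.
pose d := e / (nm f ^+ 2 + 1).
have q0 : 0 < nm f ^+ 2 + 1 by rewrite ltr_wpDl ?sqr_ge0.
have d0 : 0 < d by rewrite divr_gt0.
have := spectral_pos_strict (a := a) (b := b) (w := w) (w0 := w0 + d) f hb.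
rewrite -/S => /(_ _)/le_trans; apply => [t|].
  by rewrite addrAC ltr_wpDl.
have : d * (nm f ^+ 2 + 1) = e by rewrite /d divfK // gt_eqF.
by have := sqr_ge0 (nm f); nra.
Qed.

End Moments.

(** * Spectral null sets and the resolvent set *)

Section SpectralNullSets.
Context {R : realType} {H : completeNormedModType R[i]}.
Context {dot : {dot H for Num.conj}} (hH : hilbert dot).
Variable T : set (H * H).
Hypothesis saT : selfadjoint dot setT T.
Implicit Types (f g x y : H) (t C : R) (s : seq (R * R)) (X K : set R) (M D : set H).

Local Notation rho a b := (res T (a +i* b)).

Lemma spectral_pos_seq (s : seq (R * R * R)) (w0 : R) f :
  (forall p, p \in s -> p.1.2 != 0) ->
  (forall t, 0 <= w0 + \sum_(p <- s) p.2 / ((t - p.1.1) ^+ 2 + p.1.2 ^+ 2)) ->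
  0 <= w0 * nm f ^+ 2 + \sum_(p <- s) p.2 * nm (rho p.1.1 p.1.2 f) ^+ 2.
Proof.
move=> hb hpos; rewrite big_tnth; apply: (spectral_pos hH saT).
  by move=> i; apply: hb; apply: mem_tnth.
by move=> t; have := hpos t; rewrite big_tnth.
Qed.

(** If E is the spectral measure of T, then <E(.) f, f> gives the interval with centre
    a and radius b at most twice the mass b^2 |(T - a - i b)^-1 f|^2, because
    1 <= 2 b^2 / ((t - a)^2 + b^2) on it. So the sets [null f] below are sets of
    spectral measure zero for f, defined by finite covers of small total mass. *)
Definition mass f (p : R * R) : R := (p.2 * nm (rho p.1 p.2 f)) ^+ 2.

Definition covers s X :=
  forall t, X t -> exists2 p, p \in s & `|t - p.1| < p.2.

Definition null f X := forall e : R, 0 < e -> exists s,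
  [/\ forall p, p \in s -> 0 < p.2, covers s X & \sum_(p <- s) mass f p <= e].

Lemma le_sum_mem (I : eqType) (r : seq I) (F : I -> R) q :
  (forall p, p \in r -> 0 <= F p) -> q \in r -> F q <= \sum_(p <- r) F p.
Proof.
move=> F0 qr; rewrite (big_rem q) //= lerDl big_seq sumr_ge0 // => p /mem_rem.
exact: F0.
Qed.

(** If f has no spectral mass within distance d of l, then (T - l)^-1 is bounded
   by 1/d on f: for the intervals (a, b) of a cover of small mass
   1 / ((t - l)^2 + h^2) <= d^-2 + sum 2 b^2 / h^2 / ((t - a)^2 + b^2). *)
Lemma null_bound f (l d h : R) : 0 < d -> 0 < h ->
  null f [set t | `|t - l| <= d] -> d * nm (rho l h f) <= nm f.
Proof.
move=> d0 h0 nf; rewrite -ler_sqr ?nnegrE ?mulr_ge0 ?nm_ge0 ?(ltW d0) //.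
apply/ler_addgt0Pr => e e0; rewrite exprMn.
have d2 : 0 < d ^+ 2 by rewrite exprn_gt0.
have h2 : 0 < h ^+ 2 by rewrite exprn_gt0.
have [|s [spos scov smass]] := nf (e / (2 / h ^+ 2 * d ^+ 2)).
  by rewrite !(divr_gt0, mulr_gt0).
pose F t (p : R * R) := 2 / h ^+ 2 * p.2 ^+ 2 / ((t - p.1) ^+ 2 + p.2 ^+ 2).
have F0 t p : p \in s -> 0 <= F t p.
  move=> ps; rewrite /F divr_ge0 ?addr_ge0 ?sqr_ge0 //.
  by rewrite mulr_ge0 ?sqr_ge0 // divr_ge0 ?sqr_ge0.
have : 0 <= (d ^+ 2)^-1 * nm f ^+ 2 + \sum_(p <- (l, h, -1) ::
    [seq (p.1, p.2, 2 / h ^+ 2 * p.2 ^+ 2) | p <- s]) p.2 * nm (rho p.1.1 p.1.2 f) ^+ 2.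
  apply: (spectral_pos_seq (s := (l, h, -1) :: _)).
    move=> p; rewrite inE => /orP[/eqP->/=|]; first by rewrite gt_eqF.
    by case/mapP => q qs -> /=; rewrite gt_eqF // spos.
  move=> t; rewrite big_cons big_map /= mulN1r addrCA addrC subr_ge0.
  have [tl|tl] := leP `|t - l| d.
    have [p ps tp] := scov t tl.
    have p2 : 0 < p.2 ^+ 2 by rewrite exprn_gt0 // spos.
    have tp2 : (t - p.1) ^+ 2 <= p.2 ^+ 2.
      by rewrite -real_normK ?num_real // ler_sqr ?nnegrE ?normr_ge0 ?ltW // spos.
    apply: (le_trans _ (_ : F t p <= _)); last first.
      apply: (le_trans (le_sum_mem (F0 t) ps)); rewrite lerDr invr_ge0.
      exact: ltW.
    apply: (le_trans (_ : _ <= (h ^+ 2)^-1)).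
      by rewrite lef_pV2 ?posrE ?lerDr ?sqr_ge0 // ltr_wpDl ?sqr_ge0.
    rewrite /F ler_pdivlMr ?ltr_wpDl ?sqr_ge0 //.
    have -> : 2 / h ^+ 2 * p.2 ^+ 2 = (h ^+ 2)^-1 * (p.2 ^+ 2 + p.2 ^+ 2) by ring.
    by rewrite ler_pM2l ?invr_gt0 // lerD2r.
  apply: (le_trans (_ : _ <= (d ^+ 2)^-1)).
    rewrite lef_pV2 ?posrE ?ltr_wpDl ?sqr_ge0 // ler_wpDr ?sqr_ge0 //.
    rewrite -[X in _ <= X]real_normK ?num_real // ler_sqr ?nnegrE ?normr_ge0 ?ltW //.
  by rewrite lerDl big_seq sumr_ge0 // => p; exact: F0.
rewrite big_cons big_map /= mulN1r.
have -> : \sum_(j <- s) 2 / h ^+ 2 * j.2 ^+ 2 * nm (rho j.1 j.2 f) ^+ 2 =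
  2 / h ^+ 2 * \sum_(p <- s) mass f p.
  rewrite mulr_sumr; apply: eq_bigr => p _.
  by rewrite /mass [(p.2 * _) ^+ 2]exprMn; ring.
set r2 := nm (rho l h f) ^+ 2; set S := \sum_(p <- s) _ in smass *.
move=> h1; have : 0 <= d ^+ 2 * ((d ^+ 2)^-1 * nm f ^+ 2 + (- r2 + 2 / h ^+ 2 * S)).
  by rewrite mulr_ge0 // ltW.
have h3 : S * (2 / h ^+ 2 * d ^+ 2) <= e.
  by rewrite -ler_pdivlMr // !(divr_gt0, mulr_gt0).
rewrite !mulrDr mulrA divff ?gt_eqF // mul1r; lra.
Qed.

Lemma nullS f X Y : X `<=` Y -> null f Y -> null f X.
Proof.
move=> XY nY e e0; have [s [h1 h2 h3]] := nY e e0.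
by exists s; split => // t /XY; apply: h2.
Qed.

Lemma nullU f X Y : null f X -> null f Y -> null f (X `|` Y).
Proof.
move=> nX nY e e0; have e2 : 0 < e / 2 by rewrite divr_gt0.
have [s [h1 h2 h3]] := nX _ e2; have [s' [h1' h2' h3']] := nY _ e2.
exists (s ++ s'); split.
- by move=> p; rewrite mem_cat => /orP[]; [apply: h1 | apply: h1'].
- move=> t [/h2|/h2'] [p ps tp]; exists p => //; by rewrite mem_cat ps ?orbT.
- by rewrite big_cat /=; lra.
Qed.

(** At a point t where (T - t)^-1 f exists, (T - t - i h)^-1 f stays bounded as h
    tends to 0. *)
Definition rbound f C t := forall h : R, 0 < h -> nm (rho t h f) <= C.

Lemma ran_rbound f t : ran T t%:C f -> exists C, rbound f C t.
Proof.
case=> -[x y] /= Txy <-; exists (2 * nm x) => h h0.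
have z0 : complex.Im (t +i* h) != 0 by rewrite /= gt_eqF.
have -> : y - t%:C *: x = (y - (t +i* h) *: x) + (h%:C * 'i) *: x.
  rewrite -addrA; congr (y + _).
  rewrite addrC -scalerBl -scaleNr; congr (_ *: _).
  by apply/eqP; rewrite eq_complex /=; apply/andP; split; apply/eqP; ring.
rewrite (resD hH saT) // (resU hH saT z0 Txy) (resZ hH saT) //.
apply: (le_trans (nmD _ _)); rewrite nmZ cnM cn_i mulr1 cn_real mulrDl mul1r lerD2l.
exact: (nm_res hH saT (z := t +i* h) x z0).
Qed.

(** A uniform bound C on the resolvent over K gives the interval of radius b
   around a point of K a mass of at most (C b)^2, so that N intervals of radius
   O(1/N) have total mass O(1/N). *)
Lemma null_grid f C (al be : R) K : K `<=` [set t | al <= t <= be] ->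
  (forall t, K t -> rbound f C t) -> null f K.
Proof.
move=> Kab hK e e0.
have [[t0 Kt0]|K0] := pselect (exists t, K t); last first.
  exists [::]; split => //; last by rewrite big_nil ltW.
  by move=> t Kt; exfalso; apply: K0; exists t.
have ab : al <= be by have /andP[h1 h2] := Kab _ Kt0; apply: le_trans h2.
pose L := be - al + 1; have L0 : 0 < L by rewrite /L; lra.
have C0 : 0 <= C by apply: le_trans (hK _ Kt0 1 ltr01); exact: nm_ge0.
pose N := Num.truncn ((2 * L * C) ^+ 2 / e).
pose h := L / N.+1%:R.
have N0 : 0 < N.+1%:R :> R by rewrite ltr0n.
have h0 : 0 < h by rewrite divr_gt0.
have grid n : exists s, [/\ (size s <= n)%N,
    forall p, p \in s -> p.2 = 2 * h /\ K p.1 &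
    covers s (K `&` [set t | t < al + n%:R * h])].
  elim: n => [|n [s [s1 s2 s3]]].
    exists [::]; split => // t [Kt /=]; rewrite mul0r addr0 ltNge.
    by have /andP[->] := Kab _ Kt.
  have [[t1 [Kt1 ht1]]|nK] := pselect (exists t, K t /\ al + n%:R * h <= t < al + n.+1%:R * h).
    exists ((t1, 2 * h) :: s); split => //.
      move=> p; rewrite inE => /orP[/eqP->|]; by [split | apply: s2].
    move=> t [Kt tn]; have [tn'|tn'] := ltP t (al + n%:R * h).
      by have [p ps tp] := s3 t (conj Kt tn'); exists p => //; rewrite inE ps orbT.
    exists (t1, 2 * h); first by rewrite mem_head.
    move: tn ht1 tn'; rewrite /= -natr1 mulrDl mul1r => tn /andP[l1 l2] l3.
    by rewrite ltr_norml; apply/andP; split; lra.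
  exists s; split => //; first exact: leqW.
  move=> t [Kt tn]; have [tn'|tn'] := ltP t (al + n%:R * h); first exact: s3.
  by exfalso; apply: nK; exists t; split=> //; rewrite tn'.
have [s [s1 s2 s3]] := grid N.+1.
exists s; split.
- by move=> p /s2[-> _]; rewrite mulr_gt0.
- move=> t Kt; apply: s3; split => //=.
  rewrite /h mulrC divfK ?gt_eqF //; have /andP[_] := Kab _ Kt; rewrite /L; lra.
have m1 : \sum_(p <- s) mass f p <= \sum_(p <- s) (2 * h * C) ^+ 2.
  rewrite big_seq [leRHS]big_seq ler_sum // => p /s2[p2 Kp].
  have h2 : 0 < 2 * h by rewrite mulr_gt0.
  have h3 : 0 <= 2 * h * nm (rho p.1 (2 * h) f) by rewrite mulr_ge0 ?nm_ge0 // ltW.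
  have h4 : 0 <= 2 * h * C by rewrite mulr_ge0 // ltW.
  by rewrite /mass p2 ler_sqr ?nnegrE // ler_pM2l //; exact: (hK _ Kp).
apply: (le_trans m1); rewrite big_const_seq count_predT iter_addr_0.
apply: (le_trans (_ : _ <= N.+1%:R * (2 * h * C) ^+ 2)).
  by rewrite -[leLHS]mulr_natl ler_wpM2r ?sqr_ge0 // ler_nat.
have -> : N.+1%:R * (2 * h * C) ^+ 2 = (2 * L * C) ^+ 2 / N.+1%:R.
  by rewrite /h; field; rewrite gt_eqF.
by rewrite ler_pdivrMr // [leRHS]mulrC -ler_pdivrMr //; apply: ltW; exact: truncnS_gt.
Qed.

(** The mass of the interval of radius h around t is |h (T - t - i h)^-1 f|^2. It tends
    to 0 with h when f is in the range of T - t, by [ran_rbound], and then, h (T - t -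
    i h)^-1 being a contraction, also when f is in the closure of that range. *)
Lemma null_point f (t : R) : adherent (ran T t%:C) f -> null f [set t].
Proof.
move=> hf e e0; pose d := Num.min e 1; have d0 : 0 < d by rewrite lt_min e0 ltr01.
have [g [[x y] /= Txy gE] ng] : exists2 g, ran T t%:C g & nm (f - g) < d / 2.
  by apply: hf; rewrite divr_gt0.
have [C hC] : exists C, rbound g C t by apply: ran_rbound; exists (x, y).
have C0 : 0 <= C by apply: le_trans (hC 1 ltr01); exact: nm_ge0.
pose h := d / 2 / (C + 1).
have C1 : 0 < C + 1 by lra.
have h0 : 0 < h by rewrite !divr_gt0.
exists [:: (t, h)]; split.
- by move=> p; rewrite inE => /eqP->.
- by move=> _ ->; exists (t, h); rewrite ?mem_head //= subrr normr0.
have z0 : complex.Im (t +i* h) != 0 by rewrite /= gt_eqF.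
rewrite big_cons big_nil addr0 /mass /=.
have k1 : h * nm (rho t h (f - g)) <= d / 2.
  have := nm_res hH saT (f - g) z0; rewrite /= ger0_norm ?(ltW h0) //.
  by move=> /le_trans; apply; apply: ltW.
have k2 : h * nm (rho t h g) <= d / 2.
  apply: (le_trans (_ : _ <= h * (C + 1))); last by rewrite /h divfK // gt_eqF.
  by rewrite ler_wpM2l ?(ltW h0) //; have := hC _ h0; lra.
have k3 : h * nm (rho t h f) <= d.
  rewrite -[f in leLHS](subrK g) (resD hH saT) //.
  apply: (le_trans (_ : _ <= h * (nm (rho t h (f - g)) + nm (rho t h g)))).
    by rewrite ler_wpM2l ?(ltW h0) // nmD.
  by rewrite mulrDr; lra.
have de : d <= e by rewrite ge_min lexx.
have d1 : d <= 1 by rewrite ge_min lexx orbT.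
have := mulr_ge0 (ltW h0) (nm_ge0 (rho t h f)).
move: (h * _) k3 => m md m0; nra.
Qed.

(** Countable additivity: the n-th set is covered with mass e / 2^(n+1), and compactness
    extracts a finite cover. *)
Lemma null_bigcup f (al be : R) (X : nat -> set R) :
  [set t | al <= t <= be] `<=` \bigcup_n X n -> (forall n, null f (X n)) ->
  null f [set t | al <= t <= be].
Proof.
move=> cov hX e e0.
have [s hs] := choice (fun n => hX n (e / 2 ^+ n.+1) (divr_gt0 e0 (exprn_gt0 _ (ltr0n _ 2)))).
pose U n : set R := [set t | exists2 p, p \in s n & `|t - p.1| < p.2].
have := @segment_compact R al be; rewrite compact_cover => cpt.
have [|t tab|D _ hD] := cpt nat setT U.
- move=> n _.
  have -> : U n = \bigcup_(p in [set` s n]) ball p.1 p.2.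
    apply/seteqP; split => t [p ps pt]; exists p => //; move: pt;
      by rewrite -ball_normE /= distrC.
  by apply: bigcup_open => p _; exact: ball_open.
- have /cov[n _ Xt] : [set t | al <= t <= be] t by move: tab; rewrite /= in_itv.
  by exists n => //; case: (hs n) => _ + _; apply.
pose N := (\max_(n <- D) n).+1.
exists (flatten [seq s n | n <- iota 0 N]); split.
- by move=> p /flatten_mapP[n _ ps]; case: (hs n) => + _ _; apply.
- move=> t tab; have [|n nD [p ps pt]] := hD t; first by rewrite /= in_itv.
  exists p => //; apply/flatten_mapP; exists n => //.
  by rewrite mem_iota add0n ltnS /=; apply: leq_bigmax_seq.
have step n : \sum_(p <- flatten [seq s k | k <- iota 0 n]) mass f p <= e - e / 2 ^+ n.
  elim: n => [|n IH]; first by rewrite big_nil expr0 divr1 subrr.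
  rewrite -addn1 iotaD map_cat flatten_cat big_cat /= cats0 add0n.
  have [_ _ h] := hs n; apply: (le_trans (lerD IH h)).
  have -> : e / 2 ^+ n = e / 2 ^+ n.+1 *+ 2.
    by rewrite exprS -mulr_natr; field; rewrite expf_neq0.
  by rewrite addn1 mulr2n; lra.
by apply: (le_trans (step N)); rewrite gerBl divr_ge0 ?exprn_ge0 ?(ltW e0).
Qed.

Lemma countable_range (V : choiceType) (v0 : V) (S : set V) : countable S ->
  exists u : nat -> V, S `<=` range u.
Proof.
move=> /countable_injP[F inj]; exists (fun n => xget v0 [set v | S v /\ F v = n]).
move=> v Sv; exists (F v) => //.
have [Sx Fx] : [set w | S w /\ F w = F v] (xget v0 [set w | S w /\ F w = F v]).
  by apply: xgetPex; exists v.
by apply: inj => //; rewrite in_setE.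
Qed.

(** The spectral measure of f has no atoms on the segment and, off S, the segment is the
    union of the sets where (T - t - i h)^-1 f is bounded by n. *)
Lemma null_segment f (al be : R) (S : set R) : countable S ->
  (forall t, al <= t <= be -> ~ S t -> ran T t%:C f) ->
  (forall t, al <= t <= be -> adherent (ran T t%:C) f) ->
  null f [set t | al <= t <= be].
Proof.
move=> cS h1 h2.
have [u hu] := countable_range 0 cS.
pose B n := [set t | al <= t <= be /\ rbound f n%:R t].
pose P n := [set t | al <= t <= be /\ t = u n].
apply: (null_bigcup (X := fun n => B n `|` P n)).
  move=> t tab; have [/hu[n _ un]|/(h1 _ tab)/ran_rbound[C hC]] := pselect (S t).
    by exists n => //; right.
  exists (Num.truncn C).+1 => //; left; split => // h h0.
  by apply: (le_trans (hC _ h0)); apply/ltW/truncnS_gt.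
move=> n; apply: nullU.
  by apply: (null_grid (C := n%:R) (al := al) (be := be)) => t [].
have [uab|nuab] := pselect (al <= u n <= be).
  by apply: (nullS (Y := [set u n])) => [t [_ ->]//|]; apply: null_point; exact: h2.
move=> e e0; exists [::]; split => //; last by rewrite big_nil ltW.
by move=> t [tab tn]; exfalso; apply: nuab; rewrite -tn.
Qed.

Lemma restr_closed M : closed_subspace M -> closed (restr T M).
Proof.
move=> [_ /closed_adherent cM]; have /closed_adherent2 cT := sa_closed hH saT.
apply/closed_adherent2 => x y hxy; split; last split.
- by apply: cT => e /hxy[p [[Tp _] h1 h2]]; exists p.
- by apply: cM => e /hxy[p [[Tp [Mp _]] h1 h2]]; exists p.1.
- by apply: cM => e /hxy[p [[Tp [_ Mp]] h1 h2]]; exists p.2.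
Qed.

Lemma restr_subspace M : subspace_of M -> subspace_of (restr T M).
Proof.
move=> [M0 hM]; have [T0 hT] := sa_subspace saT; split; first by [].
move=> a p q [Tp [Mp1 Mp2]] [Tq [Mq1 Mq2]].
by split; [exact: hT | split; exact: hM].
Qed.

(** The bound extends from D to M by density; letting h tend to 0 it bounds T - l from
    below, and (T - l) (T - l - i h)^-1 f = f + i h (T - l - i h)^-1 f tends to f, so
    that the range of T - l is dense. *)
Lemma resolvent_of_bound M D (l d : R) : closed_subspace M -> D `<=` M ->
  (forall x, M x -> adherent D x) -> 0 < d ->
  (forall h x, 0 < h -> M x -> M (rho l h x)) ->
  (forall f h, D f -> 0 < h -> d * nm (rho l h f) <= nm f) ->
  resolvent_set M (restr T M) l%:C.
Proof.
move=> cM DM densD d0 Minv Dbound; have [sM _] := cM.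
have bound f h : M f -> 0 < h -> d * nm (rho l h f) <= nm f.
  move=> Mf h0; apply/ler_addgt0Pr => e e0.
  have z0 : complex.Im (l +i* h) != 0 by rewrite /= gt_eqF.
  have q0 : 0 < e / (1 + d / h) by rewrite divr_gt0 // addr_gt0 // divr_gt0.
  have [g Dg hg] := densD f Mf _ q0.
  have b1 := Dbound _ _ Dg h0.
  have b2 := nm_res hH saT (f - g) z0.
  rewrite /= ger0_norm ?(ltW h0) // in b2.
  have b3 : nm (rho l h f) <= nm (rho l h (f - g)) + nm (rho l h g).
    by have := nmD (rho l h (f - g)) (rho l h g); rewrite -(resD hH saT) // subrK.
  have b4 : nm g <= nm f + nm (f - g).
    by have := nmD f (- (f - g)); rewrite subKr nmN.
  have b5 : d * nm (rho l h (f - g)) <= d / h * nm (f - g).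
    by rewrite -mulrA ler_pM2l // mulrC ler_pdivlMr // mulrC.
  have b6 : nm (f - g) * (1 + d / h) < e.
    by rewrite -ltr_pdivlMr // addr_gt0 // divr_gt0.
  have : d * nm (rho l h f) <= d * nm (rho l h (f - g)) + d * nm (rho l h g).
    by rewrite -mulrDr ler_pM2l.
  by lra.
have below x y : restr T M (x, y) -> d * nm x <= nm (y - l%:C *: x).
  move=> [Txy [Mx My]]; apply/ler_addgt0Pr => e e0.
  pose h := e / (nm x + 1).
  have n1 : 0 < nm x + 1 by have := nm_ge0 x; lra.
  have h0 : 0 < h by rewrite divr_gt0.
  have z0 : complex.Im (l +i* h) != 0 by rewrite /= gt_eqF.
  have Mf : M (y - (l +i* h) *: x).
    by apply: subspaceB => //; apply: subspaceZ.
  have := bound _ _ Mf h0; rewrite (resU hH saT z0 Txy) => /le_trans; apply.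
  have -> : y - (l +i* h) *: x = (y - l%:C *: x) - (h%:C * 'i) *: x.
    rewrite -addrA -opprD -scalerDl; congr (y - _ *: x).
    by apply/eqP; rewrite eq_complex /=; apply/andP; split; apply/eqP; ring.
  apply: (le_trans (nmD _ _)); rewrite nmN nmZ cnM cn_i mulr1 cn_real lerD2l.
  rewrite ger0_norm ?(ltW h0) //.
  have : h * (nm x + 1) = e by rewrite /h divfK // gt_eqF.
  lra.
have below' x y : restr T M (x, y) -> nm x <= d^-1 * nm (y - l%:C *: x).
  by move=> /below h; rewrite [leRHS]mulrC ler_pdivlMr // mulrC.
split.
- apply/seteqP; split => [x /below'|x ->].
    rewrite subrr nm0 mulr0 => h; apply/eqP.
    by rewrite -nm_eq0 eq_le nm_ge0 andbT.
  by have [h _] := restr_subspace sM; rewrite /ker /= scaler0.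
- apply/seteqP; split => [_ [[x y] [_ [/= Mx My]] <-]|f Mf].
    by apply: subspaceB => //; apply: subspaceZ.
  have /closed_adherent := bounded_below_ran_closed (restr_closed cM)
    (restr_subspace sM) below'.
  apply => e e0.
  pose h := e * d / (nm f + 1).
  have n1 : 0 < nm f + 1 by have := nm_ge0 f; lra.
  have h0 : 0 < h by rewrite divr_gt0 // mulr_gt0.
  have z0 : complex.Im (l +i* h) != 0 by rewrite /= gt_eqF.
  set x := rho l h f; have Mx : M x by exact: Minv.
  exists (f + (l +i* h) *: x - l%:C *: x).
    exists (x, f + (l +i* h) *: x) => //; split; first exact: (resP hH saT).
    by split => //=; apply: subspaceD => //; apply: subspaceZ.
  have -> : f - (f + (l +i* h) *: x - l%:C *: x) = - ((h%:C * 'i) *: x).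
    rewrite -addrA -scalerBl opprD addrA subrr add0r; congr (- (_ *: _)).
    by apply/eqP; rewrite eq_complex /=; apply/andP; split; apply/eqP; ring.
  rewrite nmN nmZ cnM cn_i mulr1 cn_real ger0_norm ?(ltW h0) //.
  have b := bound _ _ Mf h0; rewrite -/x in b.
  rewrite -(ltr_pM2l d0) mulrCA.
  have : h * (nm f + 1) = e * d by rewrite /h divfK // gt_eqF.
  have : h * (d * nm x) <= h * nm f by rewrite ler_pM2l.
  lra.
exists d^-1 => x y /below' h.
by rewrite !nmE -rmorphM lecR.
Qed.

End SpectralNullSets.

(** * Reducing subspaces and defect subspaces *)

Section FiniteDimension.
Context {R : realType} {H : completeNormedModType R[i]}.

Lemma has_dim_surj (M N : set H) n (F : H -> H) : has_dim M n -> has_dim N n ->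
  (forall a x y, F (a *: x + y) = a *: F x + F y) ->
  (forall x, M x -> N (F x)) -> (forall x, M x -> F x = 0 -> x = 0) ->
  forall y, N y -> exists2 x, M x & F x = y.
Proof.
move=> [e [free_e ->]] [e' [free_e' ->]] linF FN injF y [c _ <-].
have FD x z : F (x + z) = F x + F z by rewrite -[x]scale1r linF !scale1r.
have F0 : F 0 = 0 by apply: (addrI (F 0)); rewrite -FD !addr0.
have FZ a x : F (a *: x) = a *: F x by rewrite -[a *: x]addr0 linF F0 addr0.
have Fsum (G : 'I_n -> H) : F (\sum_(i < n) G i) = \sum_(i < n) F (G i).
  exact: (big_morph F FD F0).
have Me j : [set \sum_(i < n) b i *: e i | b in [set: 'I_n -> R[i]]] (e j).
  exists (fun i => (i == j)%:R) => //; rewrite (bigD1 j) //= eqxx scale1r.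
  by rewrite big1 ?addr0 // => i /negPf->; rewrite scale0r.
have ex j : exists b : 'I_n -> R[i], \sum_(i < n) b i *: e' i = F (e j).
  by have [b _ <-] := FN _ (Me j); exists b.
have [B hB] := choice ex.
pose A := \matrix_(j < n, i < n) B j i.
have FA (r : 'rV[R[i]]_n) : F (\sum_(j < n) r 0 j *: e j) =
    \sum_(i < n) (r *m A) 0 i *: e' i.
  rewrite Fsum; under eq_bigr => j _ do
    (rewrite FZ -(hB j) scaler_sumr; under eq_bigr => i _ do rewrite scalerA).
  rewrite exchange_big; apply: eq_bigr => i _; rewrite -scaler_suml mxE.
  by congr (_ *: _); apply: eq_bigr => j _; rewrite mxE.
have uA : A \in unitmx.
  rewrite -row_free_unit; apply: inj_row_free => r rA.
  have r0 : \sum_(j < n) r 0 j *: e j = 0.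
    apply: injF; first by exists (r 0).
    by rewrite FA rA big1 // => i _; rewrite mxE scale0r.
  by apply/rowP => j; rewrite mxE; apply: (free_e (r 0)).
pose r := (\row_i c i) *m invmx A.
exists (\sum_(j < n) r 0 j *: e j); first by exists (r 0).
by rewrite FA mulmxKV //; apply: eq_bigr => i _; rewrite mxE.
Qed.

End FiniteDimension.

Section Reduction.
Context {R : realType} {H : completeNormedModType R[i]}.
Context {dot : {dot H for Num.conj}} (hH : hilbert dot).
Implicit Types (x y u v f g : H) (M D : set H) (T A : set (H * H)).

Lemma Im_i : complex.Im ('i : R[i]) != 0. Proof. exact: oner_neq0. Qed.
Lemma Im_Ni : complex.Im (- 'i : R[i]) != 0.
Proof. by rewrite /= oppr_eq0 oner_neq0. Qed.
Lemma conj_i : ('i : R[i])^*%C = - 'i.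
Proof. by apply/eqP; rewrite eq_complex /= oppr0 !eqxx. Qed.
Lemma conj_Ni : (- 'i : R[i])^*%C = 'i.
Proof. by apply/eqP; rewrite eq_complex /= oppr0 opprK !eqxx. Qed.

(** The projection onto M commutes with the resolvent at i: M is invariant by
    hypothesis, and so is its orthogonal complement, since (T + i)^-1 is the adjoint
    of (T - i)^-1. *)
Lemma reduces_of_res T M : selfadjoint dot setT T -> closed_subspace M ->
  (forall x, M x -> M (res T 'i x)) -> (forall x, M x -> M (res T (- 'i) x)) ->
  reduces dot M T.
Proof.
move=> saT cM Mi MNi; split => // -[x y] Txy; have [sM _] := cM.
have [sO _] := orth_closed_subspace hH M.
pose g := y - 'i *: x; have [Mp op] := projP hH cM g; set p := proj dot M g in Mp op.
have xE : x = res T 'i g by rewrite (resU hH saT Im_i Txy).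
have ox : orth dot M (x - res T 'i p).
  move=> m Mm; rewrite xE -(resB hH saT) ?Im_i //.
  by rewrite -conj_Ni -(res_adj hH saT) ?Im_Ni // op //; apply: MNi.
exists (res T 'i p, p + 'i *: res T 'i p); split => //=.
- exact: (resP hH saT p Im_i).
- exact: Mi.
- by apply: (subspaceD sM) => //; apply: (subspaceZ sM); exact: Mi.
have -> : y - (p + 'i *: res T 'i p) = (g - p) + 'i *: (x - res T 'i p).
  by rewrite /g scalerBr opprD !addrA [y - _ - p]addrAC subrK.
by apply: (subspaceD sO) => //; apply: (subspaceZ sO).
Qed.

(** Splitting the domain of T along M shows that a vector of M in the domain of the
    adjoint of the restriction is in the domain of T^* = T. *)
Lemma restr_selfadjoint T M : selfadjoint dot setT T -> reduces dot M T ->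
  selfadjoint dot M (restr T M).
Proof.
move=> saT [cM red]; have [sM _] := cM.
have [[_ funT] dT TE] := saT.
split.
- split; first exact: restr_subspace saT _ sM.
  by move=> x y z [Txy _] [Txz _]; apply: funT Txy Txz.
- move=> x Mx; apply/closure_nm => e e0.
  have [|u [v Tuv] hu] := (densely_definedP T).1 dT x e; first by [].
  have [q [Tq Mq1 Mq2 o1 _]] := red _ Tuv.
  exists q.1; first by exists q.2; rewrite /restr /= -surjective_pairing.
  apply: le_lt_trans hu.
  have -> : x - q.1 = proj dot M (x - u).
    have -> : x - u = (-1) *: u + x by rewrite scaleN1r addrC.
    by rewrite (proj_linear hH cM) (proj_id hH cM Mx) (projU hH cM Mq1 o1) scaleN1r addrC.
  exact: nm_proj.
apply/seteqP; split => [[x y] [Txy [Mx My]]|[x y] [/= Mx My h]].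
  by split => // -[u v] [Tuv _] /=; apply: (sa_sym saT Tuv Txy).
split; last by [].
rewrite TE; split => // p Tp /=; have [q [Tq Mq1 Mq2 o1 o2]] := red _ Tp.
have oz w z : M z -> orth dot M w -> dot w z = 0.
  by move=> Mz ow; rewrite dotC ow // conjc0.
have := h q (conj Tq (conj Mq1 Mq2)).
have -> : dot q.2 x = dot p.2 x.
  by apply/esym/subr0_eq; rewrite -dotBl; apply: oz.
by have -> : dot q.1 y = dot p.1 y by apply/esym/subr0_eq; rewrite -dotBl; apply: oz.
Qed.

Section Simple.
Variable A : set (H * H).
Hypotheses (symA : symmetric_operator dot A) (clA : closed A).
Hypothesis simpleA : simple_operator dot A.

(** A simple operator is completely non-selfadjoint, so the defect subspace at i
   generates the whole space under the resolvent of any selfadjoint extension T: on the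
   orthogonal complement of D, T coincides with A. *)
Lemma defect_generates T D : selfadjoint dot setT T -> A `<=` T ->
  subspace_of D -> defect dot A 'i `<=` D ->
  (forall x, D x -> D (res T 'i x)) -> (forall x, D x -> D (res T (- 'i) x)) ->
  forall x, adherent D x.
Proof.
move=> saT AT sD ND Di DNi; apply: (orth0_dense hH sD).
set M := orth dot D.
have cM : closed_subspace M by exact: orth_closed_subspace.
have redT : reduces dot M T.
  apply: reduces_of_res => // x Mx u Du.
    by rewrite -conj_Ni -(res_adj hH saT) ?Im_Ni //; apply: Mx; exact: DNi.
  by rewrite -conj_i -(res_adj hH saT) ?Im_i //; apply: Mx; exact: Di.
have TA : restr T M `<=` A.
  move=> [x y] [Txy [/= Mx My]].
  pose m := y - (- 'i) *: x.
  have Mm : M m by case: cM => sM _; apply: (subspaceB sM) => //; apply: (subspaceZ sM).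
  have cr : closed_subspace (ran A (- 'i)).
    split; last exact: (symmetric_ran_closed hH symA clA Im_Ni).
    by apply: ran_subspace; case: symA => -[].
  have [rp op] := projP hH cr m; set p := proj dot _ m in rp op.
  have mp : m = p.
    apply/subr0_eq/(dotxx0 hH); rewrite [RHS](_ : 0 = dot (m - p) m - dot (m - p) p).
      by rewrite dotBr.
    rewrite [dot (m - p) p]dotC op // conjc0 subr0 Mm //; apply: ND.
    by move: op; rewrite orth_ran conj_Ni.
  case: rp => -[x' y'] /= Axy' E.
  have Txy' := AT _ Axy'.
  have xx' : x = x'.
    rewrite -(resU hH saT Im_Ni Txy) -(resU hH saT Im_Ni Txy') E.
    by rewrite -/m mp.
  by rewrite -xx' in Axy' Txy'; rewrite (sa_fun saT Txy Txy').
have E : restr A M = restr T M.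
  apply/seteqP; split => p [Ap Mp]; split => //; first exact: AT.
  exact: TA.
apply: simpleA; last by rewrite E; exact: restr_selfadjoint.
split => // p /AT Tp; have [q [Tq Mq1 Mq2 o1 o2]] := redT.2 p Tp.
by exists q; split => //; apply: TA; split.
Qed.

(** On the eigenspace of a real number l the operator is multiplication by l,
   hence selfadjoint. *)
Lemma simple_ker0 (l : R) : ker A l%:C = [set 0].
Proof.
have [[sA funA] adjA] := symA; have [A0 hA] := sA.
have sK : subspace_of (ker A l%:C).
  split; first by rewrite /ker /= scaler0.
  move=> a x y Kx Ky; rewrite /ker /= scalerDr scalerA mulrC -scalerA.
  exact: (hA a _ _ Kx Ky).
have cK : closed_subspace (ker A l%:C).
  split => //; apply/closed_adherent => x hx.
  move/closed_adherent2: clA; apply => e e0.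
  have d0 : 0 < e / (`|l| + 1) by rewrite divr_gt0 // ltr_wpDl.
  have [u Ku hu] := hx _ d0.
  have hu' : nm (x - u) * (`|l| + 1) < e by rewrite -ltr_pdivlMr // ltr_wpDl.
  exists (u, l%:C *: u); split => //=.
    apply: le_lt_trans hu'; rewrite ler_peMr ?nm_ge0 // lerDr //.
  rewrite -scalerBr nmZr; have := nm_ge0 (x - u); lra.
have symK x u v : ker A l%:C x -> A (u, v) -> dot v x = l%:C * dot u x.
  move=> Kx Auv; have [_ _ /(_ _ Auv) /=] := adjA _ Kx.
  by rewrite dotZr conjc_real.
apply: simpleA.
  split => // -[x y] Axy.
  have [Mp op] := projP hH cK x; set p := proj dot _ x in Mp op.
  exists (p, l%:C *: p); split => //=; first exact: (subspaceZ sK).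
  move=> m Km; rewrite dotBr dotZr conjc_real dotC (symK _ _ _ Km Axy).
  rewrite rmorphM /= -dotC oppr0 -mulrBr -dotBr op // mulr0 //.
split.
- split; last by move=> x y z [h _] [h' _]; exact: funA h h'.
  split; first by rewrite /restr /=; split; [|split; case: sK].
  move=> a p q [Ap [Mp1 Mp2]] [Aq [Mq1 Mq2]].
  by case: sK => _ hK; split; [exact: hA | split; exact: hK].
- move=> x Kx; apply/closure_nm => e e0; exists x; last by rewrite subrr nm0.
  by exists (l%:C *: x); split => //; split => //; exact: (subspaceZ sK).
apply/seteqP; split => [[x y] [Axy [Mx My]]|[x y] [/= Mx My h]].
  by split => // -[u v] [Auv _]; have [_ _ /(_ _ Auv)] := adjA _ Axy.
have yE : y = l%:C *: x.
  apply/subr0_eq/(dotxx0 hH).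
  have Kd : ker A l%:C (y - l%:C *: x).
    by apply: (subspaceB sK) => //; apply: (subspaceZ sK).
  have := h (y - l%:C *: x, l%:C *: (y - l%:C *: x))
    (conj Kd (conj Kd (subspaceZ sK _ Kd))).
  set w := y - _ => /= hw; rewrite {2}/w dotBr -hw dotZl dotZr conjc_real subrr //.
by rewrite yE; split => //; split => //; exact: (subspaceZ sK).
Qed.

Variable d : nat.
Hypothesis hup : defect_index_upper dot A d.

(** Both sides have dimension d, and g |-> g - (l - i) (T - i)^-1 g maps
   Ker (A^* - l) into Ker (A^* - i), injectively when l is not an eigenvalue of T.
   So every f in Ker (A^* - i) is such an image, which is (T - l) (T - i)^-1 g. *)
Lemma defect_in_ran T (l : R) : selfadjoint dot setT T -> A `<=` T ->
  has_dim (ker (adjoint dot setT A) l%:C) d -> ker T l%:C = [set 0] ->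
  defect dot A 'i `<=` ran T l%:C.
Proof.
move=> saT AT dl kT f Nf.
have d_i : has_dim (defect dot A 'i) d by apply: hup; rewrite /= ltr01.
have sAd : subspace_of (adjoint dot setT A) by apply: adjoint_subspace.
have Tad : T `<=` adjoint dot setT A.
  move=> p Tp; split => // q /AT Tq; case: p q Tp Tq => [x y] [u v] Txy Tuv.
  exact: (sa_sym saT Tuv Txy).
pose c : R[i] := l%:C - 'i.
pose F g := g - c *: res T 'i g.
have linF a x y : F (a *: x + y) = a *: F x + F y.
  rewrite /F (res_linear hH saT) ?Im_i // !scalerDr scalerN !scalerA [c * a]mulrC.
  by rewrite opprD addrACA.
have FN g : ker (adjoint dot setT A) l%:C g -> defect dot A 'i (F g).
  move=> Kg; have := opB sAd Kg (opZ sAd c (Tad _ (resP hH saT g Im_i))).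
  rewrite /defect /ker /= -/(F g); congr (adjoint _ _ _ (_, _)).
  rewrite /F scalerDr scalerBr opprD addrA -scalerBl subKr.
  by rewrite !scalerA mulrC.
have injF g : ker (adjoint dot setT A) l%:C g -> F g = 0 -> g = 0.
  move=> Kg /subr0_eq gE.
  suff : ker T l%:C g by rewrite kT.
  have := opZ (sa_subspace saT) c (resP hH saT g Im_i).
  rewrite scalerDr scalerA [c * 'i]mulrC -scalerA -gE -scalerDl.
  by rewrite /c subrK.
have [g Kg <-] := has_dim_surj dl d_i linF FN injF Nf.
exists (res T 'i g, g + 'i *: res T 'i g); first exact: (resP hH saT g Im_i).
by rewrite /= /F /c scalerBl opprB addrA.
Qed.

End Simple.
End Reduction.

(** * Existence of a selfadjoint extension *)

Section Extension.
Context {R : realType} {H : completeNormedModType R[i]}.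
Context {dot : {dot H for Num.conj}} (hH : hilbert dot).
Variable A : set (H * H).
Hypotheses (symA : symmetric_operator dot A) (clA : closed A).
Hypotheses (densA : densely_defined setT A) (simpleA : simple_operator dot A).
Variable d : nat.
Hypothesis hup : defect_index_upper dot A d.
Hypothesis hlow : defect_index_lower dot A d.

(** A real l with dim Ker (A^* - l) = d yields a selfadjoint extension, the
   restriction of A^* to dom A + Ker (A^* - l): it is symmetric because l is
   real, and d dimensions are just what A - z lacks to be onto. *)
Lemma selfadjoint_extension (l : R) : has_dim (ker (adjoint dot setT A) l%:C) d ->
  exists2 T, selfadjoint dot setT T & A `<=` T.
Proof.
move=> dl; have [[sA funA] adjA] := symA; have [A0 hA] := sA.
pose N := ker (adjoint dot setT A) l%:C.
have sAd : subspace_of (adjoint dot setT A) by apply: adjoint_subspace.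
have sN : subspace_of N.
  split; first by rewrite /N /ker /= scaler0; case: sAd.
  move=> a x y Nx Ny; rewrite /N /ker /= scalerDr scalerA mulrC -scalerA.
  exact: (sAd.2 a _ _ Nx Ny).
have NA g x y : N g -> A (x, y) -> dot y g = l%:C * dot x g.
  by move=> [_ _ /(_ (x, y))] /[apply] /=; rewrite dotZr conjc_real.
pose T : set (H * H) :=
  [set p | exists q g, [/\ A q, N g & p = (q.1 + g, q.2 + l%:C *: g)]].
have AT : A `<=` T.
  move=> [x y] Axy; exists (x, y), 0; split => //; first by case: sN.
  by rewrite /= scaler0 !addr0.
have sT : subspace_of T.
  split; first exact: AT.
  move=> a _ _ [q [g [Aq Ng ->]]] [q' [g' [Aq' Ng' ->]]].
  exists (a *: q + q'), (a *: g + g'); split; [exact: hA | exact: sN.2 |].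
  congr (_, _) => /=; first by rewrite scalerDr addrACA.
  by rewrite !scalerDr addrACA !scalerA mulrC.
have symT : T `<=` adjoint dot setT T.
  move=> _ [[x y] [g [Axy Ng ->]]]; split => // _ [[u v] [h [Auv Nh ->]]] /=.
  rewrite !(dotDl, dotDr) !dotZl !dotZr conjc_real (NA _ _ _ Ng Auv).
  have [_ _ /(_ _ Auv) /= ->] := adjA _ Axy.
  by rewrite [dot h y]dotC (NA _ _ _ Nh Axy) rmorphM /= -dotC oppr0.
have dT : densely_defined setT T.
  apply/densely_definedP => x e e0.
  have [u [v Auv] hu] := (densely_definedP A).1 densA x e e0.
  by exists u => //; exists v; exact: AT.
have symoT := dense_symmetric_operator hH dT sT symT.
have ranT z : complex.Im z != 0 -> has_dim (ker (adjoint dot setT A) z^*%C) d ->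
    ran T z = setT.
  move=> z0 dz; apply/seteqP; split => // f _.
  have cr : closed_subspace (ran A z).
    by split; [exact: ran_subspace | exact: (symmetric_ran_closed hH symA clA z0)].
  (* modulo ran (A - z), the vectors of N fill the d-dimensional complement *)
  pose F g := g - proj dot (ran A z) g.
  have linF a x y : F (a *: x + y) = a *: F x + F y.
    by rewrite /F (proj_linear hH cr) opprD addrACA -scalerBr.
  have FN g : ker (adjoint dot setT A) z^*%C (F g).
    by rewrite -orth_ran; case: (projP hH cr g).
  have lz : l%:C - z != 0.
    by case: (z) z0 => a b b0; rewrite eq_complex /= sub0r oppr_eq0 (negPf b0) andbF.
  have injF g : N g -> F g = 0 -> g = 0.
    move=> Ng /subr0_eq gE.
    have : ran A z g by rewrite gE; case: (projP hH cr g).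
    case=> -[x y] /= Axy xy.
    have Tg : T (g, l%:C *: g) by exists 0, g; split => //=; rewrite !add0r.
    have := opB sT (opZ sT (l%:C - z) (AT _ Axy)) Tg.
    move/(symmetric_bound hH z symoT).
    have -> : (l%:C - z) *: y - l%:C *: g - z *: ((l%:C - z) *: x - g) = 0.
      rewrite scalerBr opprB [z *: g - _]addrC addrACA scalerA [z * _]mulrC -scalerA.
      rewrite -scalerBr xy -scaleNr -!scalerDl (_ : _ + _ = 0) ?scale0r //; ring.
    rewrite nm0 pmulr_rle0 ?normr_gt0 // => g0.
    have {g0} /subr0_eq gx : (l%:C - z) *: x - g = 0.
      by apply/eqP; rewrite -nm_eq0 eq_le g0 nm_ge0.
    suff : ker A l%:C g by rewrite (simple_ker0 hH symA clA simpleA).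
    have := opZ sA (l%:C - z) Axy; rewrite gx /ker /=; congr (A (_, _)).
    have -> : y = g + z *: x by rewrite -xy subrK.
    by rewrite scalerDr scalerA [(_ - z) * z]mulrC -scalerA gx -scalerDl subrK.
  have [g Ng gE] := has_dim_surj dl dz linF (fun g _ => FN g) injF (FN f).
  have [[x y] /= Axy xy] : ran A z (f - g).
    have -> : f - g = proj dot (ran A z) f - proj dot (ran A z) g.
      by apply/eqP; rewrite subr_eq addrAC -addrA -/(F g) gE addrC subrK.
    apply: (subspaceB cr.1); first by case: (projP hH cr f).
    by case: (projP hH cr g).
  have Tg : T (g, l%:C *: g) by exists 0, g; split => //=; rewrite !add0r.
  have h := opD sT (AT _ Axy) (opZ sT (l%:C - z)^-1 Tg).
  exists (x + (l%:C - z)^-1 *: g, y + (l%:C - z)^-1 *: (l%:C *: g)) => //=.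
  rewrite scalerDr opprD addrACA xy [z *: (_ *: g)]scalerA [z * _]mulrC -scalerA.
  by rewrite -scalerBr -scalerBl scalerA mulVf // scale1r subrK.
exists T => //; apply: (selfadjoint_of_ran hH dT sT symT).
  by apply: ranT; [exact: Im_i | apply: hlow; rewrite /= oppr_lt0 ltr01].
apply: ranT; first exact: Im_Ni.
by apply: hup; rewrite /= opprK ltr01.
Qed.

End Extension.

(** * Eigenvalues, and Baire category on a segment *)

Section Eigenvalues.
Context {R : realType} {H : completeNormedModType R[i]}.
Context {dot : {dot H for Num.conj}} (hH : hilbert dot).
Variable T : set (H * H).
Hypothesis saT : selfadjoint dot setT T.

Lemma eigen_orth (l m : R) x y : ker T l%:C x -> ker T m%:C y -> l != m ->
  dot x y = 0.
Proof.
move=> Kx Ky lm; have := sa_sym saT Kx Ky.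
rewrite dotZl dotZr conjc_real => /eqP; rewrite -subr_eq0 -mulrBl mulf_eq0.
by rewrite -rmorphB realC_eq0 subr_eq0 (negPf lm) => /eqP.
Qed.

(** Normalised eigenvectors for different eigenvalues are at distance sqrt 2. *)
Lemma point_spectrum_countable : separable H -> countable (point_spectrum T).
Proof.
move=> [S [cS dS]].
have near_S x e : 0 < e -> exists2 s, S s & nm (x - s) < e.
  move=> e0; have [||s [Bs Ss]] := dS (ball x e%:C).
  - by exists x; apply: ballxx; rewrite ltcR.
  - by apply: ball_open; rewrite ltcR.
  by exists s => //; move: Bs; rewrite -ball_normE /= nmE ltcR.
have ex l : exists v, point_spectrum T l -> ker T l%:C v /\ nm v = 1.
  have [pl|npl] := pselect (point_spectrum T l); last by exists 0.
  have [v Kv v0] : exists2 v, ker T l%:C v & v != 0.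
    apply: contrapT => nex; case/eqP: pl; apply/seteqP; split => [v Kv|v ->].
      by have [//|v0] := eqVneq v 0; exfalso; apply: nex; exists v.
    by rewrite /ker /= scaler0; case: (sa_subspace saT).
  have n0 : nm v != 0 by rewrite nm_eq0.
  exists ((nm v)^-1%:C *: v) => _; split.
    have := opZ (sa_subspace saT) (nm v)^-1%:C Kv.
    by rewrite /ker /= !scalerA mulrC.
  by rewrite nmZr ger0_norm ?invr_ge0 ?nm_ge0 // mulVf.
have [v hv] := choice ex.
have half : 0 < 2^-1 :> R by rewrite invr_gt0.
have [s hs] := choice (fun l => let: ex_intro2 x p q := near_S (v l) _ half in
  ex_intro (fun x => S x /\ nm (v l - x) < 2^-1) x (conj p q)).
move/countable_injP: cS => [F injF]; apply/countable_injP; exists (F \o s).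
move=> l m; rewrite !in_setE => pl pm /= E.
have sE : s l = s m.
  by apply: injF => //; rewrite in_setE; [exact: (hs l).1 | exact: (hs m).1].
have [Kl nl] := hv _ pl; have [Km nm1] := hv _ pm.
apply/eqP; apply: contrapT => /negP lm.
have o : dot (v l) (- v m) = 0 by rewrite dotNr (eigen_orth Kl Km lm) oppr0.
have := pythagoras hH o; rewrite nmN nl nm1.
have := nm_dist (v l) (s l) (v m); rewrite [s l in X in _ <= _ + X]sE (nmBC (s m)).
have := (hs l).2; have := (hs m).2; have := nm_ge0 (v l - v m).
nra.
Qed.

Lemma adherent_ran (l : R) f : (forall u, ker T l%:C u -> dot u f = 0) ->
  adherent (ran T l%:C) f.
Proof.
move=> h; have cr := adherent_subspace (ran_subspace l%:C (sa_subspace saT)).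
have [rp op] := projP hH cr f; set p := proj dot _ f in rp op.
suff -> : f = p by [].
apply/subr0_eq/(dotxx0 hH); rewrite dotBr h ?sub0r.
  by rewrite dotC op // conjc0 oppr0.
have : orth dot (ran T l%:C) (f - p).
  by move=> u ru; apply: op => e e0; exists u => //; rewrite subrr nm0.
by rewrite orth_ran conjc_real; case: saT => _ _ <-.
Qed.

(** The resolvent commutes with T. *)
Lemma ran_res (l : R[i]) z f : complex.Im z != 0 -> ran T l f -> ran T l (res T z f).
Proof.
move=> z0 [[x y] /= Txy <-].
exists (res T z x, x + z *: res T z x); first exact: (resP hH saT).
rewrite /= (resB hH saT) // (resZ hH saT) //; congr (_ - _).
by rewrite -{1}(resU hH saT z0 Txy) (resB hH saT) // (resZ hH saT) // subrK.
Qed.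

(** For each h > 0 the vector (T - t - i h)^-1 f depends continuously on t, by the
    resolvent identity. *)
Lemma rbound_closed n (e : 'I_n -> H) (C : R) :
  closed [set t : R | forall k, rbound T (e k) C t].
Proof.
move=> t ht k h h0; apply/ler_addgt0Pr => eps eps0.
have z0 s : complex.Im (s +i* h) != 0 by rewrite /= gt_eqF.
pose r := eps * h ^+ 2 / (nm (e k) + 1).
have n1 : 0 < nm (e k) + 1 by have := nm_ge0 (e k); lra.
have r0 : 0 < r by rewrite divr_gt0 // mulr_gt0 // exprn_gt0.
have [s [/= hs]] := ht _ (nbhsx_ballx t r r0).
rewrite -ball_normE /= => ts.
rewrite -[res T (t +i* h) _](subrK (res T (s +i* h) (e k))) addrC.
apply: (le_trans (nmD _ _)); apply: lerD; first exact: hs.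
rewrite (res_res hH saT) // nmZ.
have -> : (t +i* h) - (s +i* h) = (t - s)%:C :> R[i].
  by apply/eqP; rewrite eq_complex /= subrr !eqxx.
rewrite cn_real.
have b1 := nm_res hH saT (e k) (z0 s).
have b2 := nm_res hH saT (res T (s +i* h) (e k)) (z0 t).
rewrite /= ger0_norm ?(ltW h0) // in b1 b2.
have b3 : h ^+ 2 * nm (res T (t +i* h) (res T (s +i* h) (e k))) <= nm (e k).
  by rewrite expr2 -mulrA; apply: le_trans b1; rewrite ler_pM2l.
have h2 : 0 < h ^+ 2 by rewrite exprn_gt0.
rewrite -(ler_pM2l h2) mulrCA.
apply: (le_trans (_ : _ <= r * (nm (e k) + 1))); last first.
  by rewrite /r divfK ?gt_eqF // mulrC.
by apply: ler_pM => //; [rewrite mulr_ge0 ?nm_ge0 // ltW | exact: ltW | lra].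
Qed.

End Eigenvalues.

Section RealLine.
Context {R : realType}.
Implicit Types (a b : \bar R) (t : R).

Lemma oint_near a b t : oint a b t ->
  exists2 d : R, 0 < d & forall s, `|s - t| <= d -> oint a b s.
Proof.
move=> [ta tb].
have [d1 d10 h1] : exists2 d : R, 0 < d & forall s, `|s - t| <= d -> (a < s%:E)%E.
  case: a ta => [a||] //; rewrite ?lte_fin => ta.
    exists ((t - a) / 2); first lra.
    by move=> s; rewrite lte_fin ler_norml => /andP[]; lra.
  by exists 1 => // s _; rewrite ltNyr.
have [d2 d20 h2] : exists2 d : R, 0 < d & forall s, `|s - t| <= d -> (s%:E < b)%E.
  case: b tb => [b||] //; rewrite ?lte_fin => tb.
    exists ((b - t) / 2); first lra.
    by move=> s; rewrite lte_fin ler_norml => /andP[]; lra.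
  by exists 1 => // s _; rewrite ltry.
exists (Num.min d1 d2); first by rewrite lt_min d10.
by move=> s; rewrite le_min => /andP[hs1 hs2]; split; [apply: h1 | apply: h2].
Qed.

Lemma oint_segment a b : (a < b)%E ->
  exists c d : R, c < d /\ forall t, c <= t <= d -> oint a b t.
Proof.
move=> ab; have [t tab] : exists t, oint a b t.
  case: a b ab => [a||] [b||] //=; rewrite ?lte_fin => ab.
  - by exists ((a + b) / 2); split; rewrite lte_fin; lra.
  - by exists (a + 1); split; rewrite ?ltry // lte_fin; lra.
  - by exists (b - 1); split; rewrite ?ltNyr // lte_fin; lra.
  - by exists 0; split; rewrite ?ltNyr ?ltry.
have [e e0 he] := oint_near tab.
exists (t - e), (t + e); split; first lra.
by move=> s hs; apply: he; rewrite ler_norml; lra.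
Qed.

(** Baire's theorem: if no K n contained an interval, the complements of the sets
    K n and of the points of S would be dense open sets with empty intersection in
    the segment. *)
Lemma baire_segment (K : nat -> set R) (S : set R) (al be : R) : al < be ->
  (forall n, closed (K n)) -> countable S ->
  (forall t, al <= t <= be -> S t \/ exists n, K n t) ->
  exists n c d, [/\ al <= c, c < d, d <= be & forall t, c <= t <= d -> K n t].
Proof.
move=> ab cK cS cov; apply: contrapT => nex.
have [u hu] := countable_range 0 cS.
pose I : set R := [set t | al <= t <= be].
have cI : closed I.
  have -> : I = `[al, be]%classic by apply/seteqP; split => t; rewrite /= in_itv.
  exact: interval_closed.
pose U n : set R := ~` (K n `&` I) `&` ~` [set u n].
have odU n : open (U n) /\ dense (U n).
  split.
    apply: openI; apply: closed_openC; first exact: closedI.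
    exact/accessible_closed_set1/hausdorff_accessible/Rhausdorff.
  move=> O [x Ox] oO; apply: contrapT => nO.
  have /nbhs_ballP[r /= r0 xr] : nbhs x O by exact: open_nbhs_nbhs.
  have inK t : `|t - x| < r -> t != u n -> K n t /\ I t.
    move=> tx tu; apply: contrapT => nK; apply: nO; exists t; split; last first.
      by split => //= /eqP; rewrite (negPf tu).
    by apply: xr; rewrite -ball_normE /= distrC.
  apply: nex; exists n.
  (* take the half of the ball that misses the point u n, and shrink it *)
  have [ux|ux] := leP (u n) x.
    have P t : x + r / 4 <= t <= x + r / 2 -> K n t /\ I t.
      move=> /andP[t1 t2]; apply: inK; last by rewrite gt_eqF //; lra.
      by rewrite ltr_norml; lra.
    exists (x + r / 4), (x + r / 2); split; last by move=> t /P[].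
    - by have [|_ /andP[]] := P (x + r / 4); first lra.
    - lra.
    - by have [|_ /andP[]] := P (x + r / 2); first lra.
  have P t : x - r / 2 <= t <= x - r / 4 -> K n t /\ I t.
    move=> /andP[t1 t2]; apply: inK; last by rewrite lt_eqF //; lra.
    by rewrite ltr_norml; lra.
  exists (x - r / 2), (x - r / 4); split; last by move=> t /P[].
  - by have [|_ /andP[]] := P (x - r / 2); first lra.
  - lra.
  - by have [|_ /andP[]] := P (x - r / 4); first lra.
have dU := @Baire R R^o U odU.
have [||t [tab hU]] := dU `]al, be[%classic.
- by exists ((al + be) / 2); rewrite /= in_itv /=; lra.
- exact: interval_open.
have It : al <= t <= be by move: tab; rewrite /= in_itv /=; lra.
have [/hu[n _ tn]|[n Kt]] := cov t It.
  by have [_ /=] := hU n Logic.I; rewrite tn.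
by have [/= h _] := hU n Logic.I; apply: h.
Qed.

End RealLine.

(** * Spectra of the selfadjoint extensions *)

Section SpectraOfExtensions.
Context {R : realType} {H : completeNormedModType R[i]}.
Context {dot : {dot H for Num.conj}} (hH : hilbert dot).
Hypothesis sepH : separable H.
Variable A : set (H * H).
Hypotheses (symA : symmetric_operator dot A) (clA : closed A).
Hypothesis simpleA : simple_operator dot A.
Variable d : nat.
Hypothesis hup : defect_index_upper dot A d.
Variables mu1 mu2 : \bar R.
Hypothesis hcount : countable (oint mu1 mu2 `\`
  [set l | oint mu1 mu2 l /\ has_dim (ker (adjoint dot setT A) l%:C) d]).
Variable T : set (H * H).
Hypotheses (saT : selfadjoint dot setT T) (AT : A `<=` T).

(** The exceptional points are those where the defect is not d, and the eigenvalues
    of T, of which there are countably many because H is separable. *)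
Lemma defect_in_ran_cocountable : exists2 S : set R, countable S &
  forall t, oint mu1 mu2 t -> ~ S t -> defect dot A 'i `<=` ran T t%:C.
Proof.
exists ((oint mu1 mu2 `\`
  [set l | oint mu1 mu2 l /\ has_dim (ker (adjoint dot setT A) l%:C) d])
  `|` point_spectrum T).
  set X := _ `\` _; rewrite (_ : X `|` _ =
    \bigcup_(b in [set: bool]) (if b then X else point_spectrum T)); last first.
    apply/seteqP; split => [t [Xt|pt]|t [[] _ ht]]; [by exists true | by exists false | |].
      by left.
    by right.
  apply: bigcup_countable => // -[] _ //.
  exact: (point_spectrum_countable hH saT).
move=> t tI nS; apply: (defect_in_ran hH hup saT AT).
  by apply: contrapT => nd; apply: nS; left; split => // -[].
by apply: contrapT => /eqP nk; apply: nS; right.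
Qed.

Lemma cont_subspaceP x : cont_subspace dot T x <->
  forall (l : R) u, ker T l%:C u -> dot u x = 0.
Proof.
split=> [h l u Ku|h].
  have [u0|u0] := eqVneq u 0; first by rewrite u0 dot0l.
  apply: h => E [_ SE]; apply: SE; exists l => //.
  by apply/eqP => K0; move: Ku u0; rewrite K0 => ->; rewrite eqxx.
pose E := [set u : H | dot u x = 0].
have cE : closed_subspace E.
  split; first split.
  - exact: dot0l.
  - by move=> a u v /= Eu Ev; rewrite /E /= dotDl dotZl Eu Ev mulr0 addr0.
  by apply/closed_adherent => u hu; apply: (dot_near0 hH (M := E)).
by move=> u /(_ E); apply; split => // v [l _] /h.
Qed.

(** The vectors f in the range of T - t for all t in the interval outside S are dense, and
    so are their projections on the continuous subspace M. The latter are
    orthogonal to all eigenvectors, hence in the closure of the range of every T - t, so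
    that the interval is a null set for them. *)
Lemma cont_spectrum_empty :
  real_trace (cont_spectrum dot T) `&` oint mu1 mu2 = set0.
Proof.
apply/seteqP; split => // l [/= lc lI]; apply: lc.
have [S cS ranS] := defect_in_ran_cocountable.
set M := cont_subspace dot T.
have cM : closed_subspace M by exact: orth_closed_subspace.
have sM := cM.1.
have Mres z x : complex.Im z != 0 -> M x -> M (res T z x).
  move=> z0 /cont_subspaceP Mx; apply/cont_subspaceP => t u Ku.
  have z1 : complex.Im z^*%C != 0 by case: (z) z0 => a b; rewrite /= oppr_eq0.
  rewrite -[z]conjcK -(res_adj hH saT) //; have := Mx t u Ku.
  rewrite -{1}(resU hH saT z1 Ku) -scalerBl (resZ hH saT) // dotZl => /eqP.
  rewrite mulf_eq0 => /orP[|/eqP//]; case: (z) z0 => a b b0.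
  by rewrite eq_complex /= opprK add0r (negPf b0) andbF.
pose D := [set f | forall t, oint mu1 mu2 t -> ~ S t -> ran T t%:C f].
have sD : subspace_of D.
  have sR t := ran_subspace t%:C (sa_subspace saT).
  split=> [t _ _|a x y Dx Dy t tI nS]; first by case: (sR t).
  by apply: (sR t).2; [exact: Dx | exact: Dy].
have Dres z x : complex.Im z != 0 -> D x -> D (res T z x).
  by move=> z0 Dx t tI nS; apply: (ran_res hH saT) => //; exact: Dx.
have dD : forall x, adherent D x.
  apply: (defect_generates hH symA clA simpleA saT AT sD).
  - by move=> f Nf t tI nS; exact: (ranS _ tI nS).
  - by move=> x; apply: Dres; exact: Im_i.
  - by move=> x; apply: Dres; exact: Im_Ni.
have [e e0 he] := oint_near lI.
have redM : reduces dot M T.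
  by apply: (reduces_of_res hH) => // x; apply: Mres; [exact: Im_i | exact: Im_Ni].
apply: (resolvent_of_bound hH saT (D := [set proj dot M f | f in D]) (d := e)) => //.
- by move=> _ [f _ <-]; case: (projP hH cM f).
- move=> x Mx eps eps0; have [f Df hf] := dD x eps eps0.
  exists (proj dot M f); first by exists f.
  apply: le_lt_trans hf.
  have -> : x - proj dot M f = proj dot M (x - f).
    have -> : x - f = (-1) *: f + x by rewrite scaleN1r addrC.
    by rewrite (proj_linear hH cM) (proj_id hH cM Mx) scaleN1r addrC.
  exact: nm_proj.
- by move=> h x h0; apply: Mres; rewrite /= gt_eqF.
move=> _ h [f Df <-] h0; apply: (null_bound hH saT e0 h0).
have [Mp op] := projP hH cM f; set p := proj dot M f in Mp op *.
apply: (nullS (Y := [set t | l - e <= t <= l + e])).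
  by move=> t; rewrite /= ler_norml; lra.
have inI t : l - e <= t <= l + e -> oint mu1 mu2 t.
  by move=> ht; apply: he; rewrite ler_norml; lra.
apply: (null_segment hH saT cS).
  move=> t /inI tI nS; have [[x y] /= Txy xy] := Df t tI nS.
  have [[u v] [/= Tuv Mu Mv ou ov]] := redM.2 _ Txy.
  exists (u, v) => //=; apply/esym/(projU hH cM).
    by apply: (subspaceB sM) => //; apply: (subspaceZ sM).
  have [sO _] := orth_closed_subspace hH M.
  have -> : f - (v - t%:C *: u) = (y - v) - t%:C *: (x - u).
    by rewrite -xy scalerBr !opprB [_ - v]addrC addrACA [- (_ *: x) + _]addrC.
  by apply: (subspaceB sO) => //; apply: (subspaceZ sO).
move=> t _; apply: (adherent_ran hH saT) => u Ku.
by move/cont_subspaceP: Mp => /(_ t); apply.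
Qed.

(** By Baire's theorem (T - t - i h)^-1 is bounded, uniformly in t and h, on a basis of
    Ker (A^* - i), as t runs through some subinterval. The vectors with such a bound
    are invariant under the resolvents, hence dense, and the subinterval is a null
    set for them. *)
Lemma spectrum_nowhere_dense :
  nowhere_dense_in mu1 mu2 (real_trace (spectrum setT T) `&` oint mu1 mu2).
Proof.
split; first by move=> t [].
move=> a1 b1 ab sub.
have [S cS ranS] := defect_in_ran_cocountable.
have [al [be [albe hab]]] := oint_segment ab.
have [e [free_e eN]] : has_dim (defect dot A 'i) d by apply: hup; rewrite /= ltr01.
have Ne k : defect dot A 'i (e k).
  rewrite eN; exists (fun i => (i == k)%:R) => //; rewrite (bigD1 k) //= eqxx scale1r.
  by rewrite big1 ?addr0 // => i /negPf->; rewrite scale0r.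
pose K n := [set t : R | forall k, rbound T (e k) n%:R t].
have [||n [c [c' [alc cc c'be hK]]]] := baire_segment (K := K) albe _ cS.
- by move=> n; exact: (rbound_closed hH saT).
- move=> t tab; have [St|nSt] := pselect (S t); [by left | right].
  have tI : oint mu1 mu2 t by apply/sub/hab.
  have [C hC] := choice (fun k => ran_rbound hH saT (ranS t tI nSt _ (Ne k))).
  pose B := \sum_(k < d) `|C k|.
  exists (Num.truncn B).+1 => k h h0; apply: (le_trans (hC k h h0)).
  apply: (le_trans (ler_norm _)); apply: (le_trans (_ : _ <= B)).
    by rewrite /B (bigD1 k) //= lerDl sumr_ge0.
  by apply: ltW; exact: truncnS_gt.
exists c%:E, c'%:E; split.
- by rewrite lte_fin.
- move=> t [t1 t2]; apply: hab; rewrite !lte_fin in t1 t2; lra.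
apply/seteqP; split => // l [[/= ls _] [l1 l2]]; apply: ls.
rewrite !lte_fin in l1 l2.
pose D := [set f | exists C, forall t, c <= t <= c' -> rbound T f C t].
have sD : subspace_of D.
  split.
    exists 0 => t _ h h0; have z0 : complex.Im (t +i* h) != 0 by rewrite /= gt_eqF.
    by rewrite -[0]subr0 (resB hH saT) // subrr nm0.
  move=> a x y [Cx hx] [Cy hy]; exists (cn a * Cx + Cy) => t ht h h0.
  have z0 : complex.Im (t +i* h) != 0 by rewrite /= gt_eqF.
  rewrite (res_linear hH saT) //; apply: (le_trans (nmD _ _)); rewrite nmZ.
  by apply: lerD; [rewrite ler_wpM2l ?cn_ge0 //; exact: hx | exact: hy].
have Dres z x : complex.Im z != 0 -> D x -> D (res T z x).
  move=> z0 [C hC]; exists (C / `|complex.Im z|) => t ht h h0.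
  have z1 : complex.Im (t +i* h) != 0 by rewrite /= gt_eqF.
  rewrite (resC hH saT) // ler_pdivlMr ?normr_gt0 // mulrC.
  by apply: (le_trans (nm_res hH saT _ z0)); exact: hC.
have dD : forall x, adherent D x.
  apply: (defect_generates hH symA clA simpleA saT AT sD).
  - rewrite eN => _ [b _ <-]; apply: (subspace_sum sD) => k; apply: (subspaceZ sD).
    by exists n%:R => t ht; apply: hK.
  - by move=> x; apply: Dres; exact: Im_i.
  - by move=> x; apply: Dres; exact: Im_Ni.
pose r := Num.min (l - c) (c' - l).
have r0 : 0 < r by rewrite lt_min !subr_gt0 l1.
have -> : T = restr T setT by rewrite /restr setXTT setIT.
apply: (resolvent_of_bound hH saT (D := D) (d := r)) => //.
move=> f h [C hC] h0; apply: (null_bound hH saT r0 h0).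
have inJ t : `|t - l| <= r -> c <= t <= c'.
  by rewrite le_min !ler_norml => /andP[]; lra.
by apply: (null_grid inJ) => t /inJ; exact: hC.
Qed.

End SpectraOfExtensions.

Theorem theorem3p5 (R : realType) (H : completeNormedModType R[i])
    (dot : {dot H for Num.conj}) (A : set (H * H)) (d : nat)
    (mu1 mu2 : \bar R)
    (hH : hilbert dot) (hsep : separable H)
    (hsym : symmetric_operator dot A) (hcl : closed A)
    (hdense : densely_defined setT A) (hsimple : simple_operator dot A)
    (hup : defect_index_upper dot A d) (hlow : defect_index_lower dot A d)
    (hmu : (mu1 < mu2)%E)
    (hcount : countable (oint mu1 mu2 `\`
       [set l | oint mu1 mu2 l /\ has_dim (ker (adjoint dot setT A) l%:C) d])) :
  (forall A' : set (H * H), selfadjoint dot setT A' -> A `<=` A' ->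
     real_trace (cont_spectrum dot A') `&` oint mu1 mu2 = set0 /\
     nowhere_dense_in mu1 mu2
       (real_trace (spectrum setT A') `&` oint mu1 mu2)) /\
  nowhere_dense_in mu1 mu2
    (oint mu1 mu2 `\` (real_trace (reg_type A) `&` oint mu1 mu2)).
Proof.
have part1 A' : selfadjoint dot setT A' -> A `<=` A' ->
    real_trace (cont_spectrum dot A') `&` oint mu1 mu2 = set0 /\
    nowhere_dense_in mu1 mu2 (real_trace (spectrum setT A') `&` oint mu1 mu2).
  move=> saA' AA'; split.
    exact: (cont_spectrum_empty hH hsep hsym hcl hsimple hup hcount saA' AA').
  exact: (spectrum_nowhere_dense hH hsep hsym hcl hsimple hup hcount saA' AA').
split => //.
(* a nondegenerate interval is uncountable, here by Baire's theorem *)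
have [l [lI dl]] : exists l, oint mu1 mu2 l /\ has_dim (ker (adjoint dot setT A) l%:C) d.
  apply: contrapT => nl; have [al [be [albe hab]]] := oint_segment hmu.
  have [||n [c [c' [_ cc _ h]]]] := baire_segment (K := fun=> set0) albe _ hcount.
  - by move=> _; exact: closed0.
  - by move=> t /hab tI; left; split => // -[_ dt]; apply: nl; exists t.
  by apply: (h c); rewrite lexx ltW.
have [T saT AT] := selfadjoint_extension hH hsym hcl hdense hsimple hup hlow dl.
have [_ [_ nd]] := part1 T saT AT.
split; first by move=> t [].
move=> a1 b1 ab sub; have [a2 [b2 [ab2 sub2 h]]] := nd a1 b1 ab sub.
exists a2, b2; split => //; apply/seteqP; split => // t [[tI ntreg] tab].
suff : (real_trace (spectrum setT T) `&` oint mu1 mu2 `&` oint a2 b2) t by rewrite h.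
split => //; split => // -[kT _ [c hc]]; apply: ntreg; split => //; split.
  exact: (simple_ker0 hH hsym hcl hsimple).
apply: (bounded_below_ran_closed (c := c)) => //; first by case: hsym => -[].
by move=> x y /AT/hc; rewrite !nmE -rmorphM lecR.
Qed.
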